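(* There is an absolute constant $c>0$ such that for all $g\ge 3$ and all $n$ sufficiently large in terms of $g$, there is a $3$-graph $\Gamma$ on at least $n^{cn/g}$ vertices such that the link of each vertex of $\Gamma$ has odd girth greater than $g$ and the complement of $\Gamma$ contains no copy of $K_{n,n,n}^{(3)}$.
   Context: A $3$-graph is a $3$-uniform hypergraph. The link of a vertex $v$ in a $3$-graph $F$ is the graph on $V(F)\setminus\{v\}$ whose edges are the pairs $e$ with $e\cup\{v\}\in E(F)$. The odd girth of a graph is the length of its shortest odd cycle (infinite for a bipartite graph). $K_{n,n,n}^{(3)}$ is the $3$-graph on $3n$ vertices split into three parts of size $n$ whose edges are exactly the triples with one vertex in each part. The complement of $\Gamma$ has the same vertex set and exactly the triples that are not edges of $\Gamma$. *)

(* Defs.v *)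
From HB Require Import structures.
From mathcomp Require Import all_boot all_order all_algebra.
From mathcomp Require Import all_classical all_reals all_analysis.

Set Implicit Arguments.
Unset Strict Implicit.
Unset Printing Implicit Defensive.

Import Order.TTheory GRing.Theory Num.Theory.

Local Open Scope nat_scope.

Record hypergraph (r : nat) (V : finType) := Hypergraph {
  edges : {set {set V}};
  edges_uniform : [forall e in edges, #|e| == r]
}.

Notation graph := (hypergraph 2).
Notation threegraph := (hypergraph 3).

Lemma hgraph_uniform r (V : finType) (P : pred {set V}) :
  [forall e in [set e : {set V} | (#|e| == r) && P e], #|e| == r].
Proof. by apply/forall_inP => e; rewrite inE => /andP[]. Qed.

Definition hgraph r (V : finType) (P : pred {set V}) : hypergraph r V :=
  Hypergraph (hgraph_uniform r P).

Definition link (V : finType) (F : threegraph V) (v : V) :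
    graph {u : V | u != v} :=
  @hgraph 2 _ (fun e => (v |: [set val u | u in e]) \in edges F).

Definition complement r (V : finType) (F : hypergraph r V) : hypergraph r V :=
  @hgraph r V (fun e => e \notin edges F).

Definition complete_tripartite (n : nat) : threegraph ('I_3 * 'I_n)%type :=
  @hgraph 3 _ (fun e => [forall i : 'I_3, #|[set x in e | x.1 == i]| == 1]).

(* Copies are subgraphs, not necessarily induced. *)
Definition contains_copy r (W V : finType) (K : hypergraph r W)
    (H : hypergraph r V) : Prop :=
  exists2 f : W -> V, injective f &
    forall e : {set W}, e \in edges K -> [set f x | x in e] \in edges H.

Definition adj (V : finType) (G : graph V) : rel V :=
  fun x y => [set x; y] \in edges G.

Definition is_cycle (V : finType) (G : graph V) (s : seq V) : bool :=
  (2 < size s) && ucycleb (adj G) s.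

(* [ereal_inf set0 = +oo] gives the value on bipartite graphs. *)
Definition odd_girth (R : realType) (V : finType) (G : graph V) : \bar R :=
  ereal_inf [set ((size s)%:R)%:E | s in
    [set s : seq V | is_cycle G s /\ odd (size s)]]%classic.

(* Main.v *)
Require Import Defs.
From HB Require Import structures.
From mathcomp Require Import all_boot all_order all_algebra.
From mathcomp Require Import zify ring.

(** Let [H] be a graph on [m] vertices without odd cycles of length at most [g],
    in which any two sets of [s = m^(1 - c/g)] vertices span an edge; a random
    graph with one vertex of every short odd cycle deleted is such an [H]. Give
    every ordered pair [(v, u)] of vertices of [V] a random label [chi (v, u)] in
    [H], and let [{u, v, w}] be an edge of [Gamma] when each of its vertices sees
    adjacent labels on the other two. The link of [v] then maps
    homomorphically to [H] by [u |-> chi (v, u)], so it has odd girth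
    greater than [g].

    Fix disjoint [n]-sets [A], [B], [C], where [n] is larger than a fixed power
    of [m], and put [k = m / (3 s)]. The claim is that [A], [B], [C] span no edge
    with probability at most [2^(6 n^2) k^(- n^2 / 64)]; a union bound over
    [A], [B], [C] then allows [k^(c n)] vertices. For [a] in [A], [b] in [B], let
    [W_ab] be the set of pairs [(chi (a, c), chi (b, c))] over the [c] in [C] for
    which [chi (c, a)] and [chi (c, b)] are adjacent. If [W_ab] has at least
    [3 s m] elements, then only [3 s m] values of [(chi (a, b), chi (b, a))]
    create no edge, a saving of a factor [k]; so suppose that fewer than
    [n^2 / 64] pairs [(a, b)] have such a large [W_ab]. For all but few [c] the
    labels [chi (c, .)] are spread out enough that the adjacent pairs [(a, b)]
    with small [W_ab] contain many disjoint matchings of size [n / 8]. Reveal the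
    elements [c] one at a time: a pair contributes a new element to its [W_ab] at
    most [m^2] times, so for most [c] half of some matching contributes nothing
    new, which confines [(chi (a, c), chi (b, c))] to a set of fewer than [3 s m]
    elements for [n / 16] disjoint pairs [(a, b)], a saving of [k^(n / 16)]. *)

Set Implicit Arguments.
Unset Strict Implicit.
Unset Printing Implicit Defensive.

Import Order.TTheory GRing.Theory Num.Theory.

Local Open Scope nat_scope.

(** * Counting *)

(* [(x, v) |-> (set x v, get x)] is injective. *)
Lemma card_resample (X V : finType) (get : X -> V) (set : X -> V -> X)
    (P' P : {set X}) (F : X -> {set V}) k c :
  (forall x v, get (set x v) = v) ->
  (forall x v, set (set x v) (get x) = x) ->
  (forall x v, x \in P' -> set x v \in P) ->
  (forall x v, F (set x v) = F x) ->
  (forall x, x \in P' -> get x \in F x) ->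
  (forall x, x \in P -> k * #|F x| <= c * #|V|) ->
  k * #|P'| <= c * #|P|.
Proof.
move=> getK setK P'P Fset getF cF.
case: (posnP #|V|) => [V0|V_gt0].
  suff -> : P' = set0 by rewrite cards0 muln0.
  apply/setP=> x; rewrite inE; apply/negbTE/negP=> _.
  have : #|V| > 0 by apply/card_gt0P; exists (get x).
  by rewrite V0.
rewrite -(leq_pmul2r V_gt0) -mulnA (mulnAC c).
have -> : #|P'| * #|V| = #|setX P' [set: V]| by rewrite cardsX cardsT.
pose Y := [set y : X * V | (y.1 \in P) && (y.2 \in F y.1)].
have YX : #|setX P' [set: V]| <= #|Y|.
  pose h (y : X * V) := (set y.1 y.2, get y.1).
  have h_inj : injective h.
    move=> [x v] [x' v'] [] /= e1 e2; congr pair.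
      by rewrite -(setK x v) e1 e2 setK.
    by rewrite -(getK x v) e1 getK.
  rewrite -(card_imset _ h_inj); apply/subset_leq_card/subsetP=> y.
  case/imsetP=> -[x v]; rewrite !inE andbT /= => xP' ->.
  by rewrite /= P'P // Fset getF.
have cY : #|Y| = \sum_(x in P) #|F x|.
  rewrite -sum1_card.
  rewrite (eq_bigl (fun y => (y.1 \in P) && (y.2 \in F y.1))); last first.
    by move=> y; rewrite inE.
  rewrite -(pair_big_dep (fun x => x \in P) (fun x v => v \in F x) (fun _ _ => 1)).
  by apply: eq_bigr=> x _; rewrite sum1_card.
apply: leq_trans (leq_mul (leqnn k) YX) _.
rewrite cY big_distrr /=.
apply: leq_trans (_ : _ <= \sum_(x in P) c * #|V|) _; first exact: leq_sum.
by rewrite sum_nat_const mulnC.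
Qed.

(** Probabilities are kept as cardinalities with denominators cleared: probability at most [c / k]
    reads [k * #|P| <= c * #|X|]. In this form a union bound over [I] costs the factor [#|I|]. *)
Lemma card_union_bound (X I : finType) (P : {set X}) (Y : I -> {set X}) k t :
  (forall x, x \in P -> exists i, x \in Y i) ->
  (forall i, k * #|Y i| <= t) -> k * #|P| <= #|I| * t.
Proof.
move=> PY cY.
have sP : P \subset \bigcup_i Y i.
  by apply/subsetP=> x /PY [i xi]; apply/bigcupP; exists i.
apply: leq_trans (leq_mul (leqnn k) (subset_leq_card sP)) _.
have le : #|\bigcup_i Y i| <= \sum_i #|Y i|.
  apply: (big_ind2 (fun (A : {set X}) a => #|A| <= a)) => [|A a B b hA hB|i _] //.
    by rewrite cards0.
  by apply: leq_trans (leq_of_leqif (leq_card_setU A B)) _; apply: leq_add.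
apply: leq_trans (leq_mul (leqnn k) le) _.
rewrite big_distrr /= -sum_nat_const; exact: leq_sum.
Qed.

(** Conditioning on the first coordinate: a bound uniform over the sections is summed over [X]. *)
Lemma card_fiber_bound (X Y : finType) (P : {set X * Y}) k t :
  (forall x, k * #|[set y | (x, y) \in P]| <= t) -> k * #|P| <= #|X| * t.
Proof.
move=> h.
apply: (@card_union_bound _ _ _ (fun x => [set z in P | z.1 == x])).
  by move=> z zP; exists z.1; rewrite inE zP eqxx.
move=> x; apply: leq_trans (h x); rewrite leq_mul2l; apply/orP; right.
have inj : {in [set z in P | z.1 == x] &, injective (fun z : X * Y => z.2)}.
  move=> [a b] [a' b']; rewrite !inE /= => /andP[_ /eqP->] /andP[_ /eqP->].
  by move=> /= ->.
rewrite -(card_in_imset inj); apply/subset_leq_card/subsetP=> y.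
by case/imsetP=> -[a b]; rewrite !inE /= => /andP[abP /eqP <-] ->.
Qed.

(** The coordinates are revealed in increasing order. As [F j] depends only on values before [j],
    each [j] in [D] gives a conditional factor [c / k], although the sets [F j] are not fixed in
    advance. *)
Lemma card_sequential n (T : finType) (D : {set 'I_n})
    (F : 'I_n -> {ffun 'I_n -> T} -> {set T}) (k c : nat) :
  0 < c ->
  (forall (j : 'I_n) (f f' : {ffun 'I_n -> T}), (forall i : 'I_n, i < j -> f i = f' i) ->
     F j f = F j f') ->
  (forall j f, j \in D -> k * #|F j f| <= c * #|T|) ->
  k ^ #|D| * #|[set f : {ffun 'I_n -> T} | [forall j in D, f j \in F j f]]|
    <= c ^ n * #|T| ^ n.
Proof.
move=> c_gt0 Fprev cF.
pose Dj j := [set i in D | i < j].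
pose P j := [set f : {ffun 'I_n -> T} | [forall i in Dj j, f i \in F i f]].
have main : forall j, j <= n -> k ^ #|Dj j| * #|P j| <= c ^ j * #|T| ^ n.
  elim=> [|j IH] jn.
    have -> : Dj 0 = set0 by apply/setP=> i; rewrite !inE ltn0 andbF.
    rewrite cards0 !expn0 !mul1n; apply: leq_trans (max_card _) _.
    by rewrite card_ffun card_ord.
  have IHj := IH (ltnW jn); pose o := Ordinal jn.
  case: (boolP (o \in D)) => oD; last first.
    have -> : Dj j.+1 = Dj j.
      apply/setP=> i; rewrite !inE ltnS leq_eqVlt.
      case: (boolP (i \in D)) => //= iD; case: eqP => //= ij.
      by case/negP: oD; suff <- : i = o by []; apply/val_inj.
    suff -> : P j.+1 = P j.
      by apply: leq_trans IHj _; rewrite expnS -mulnA leq_pmull.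
    apply/setP=> f; rewrite !inE; apply: eq_forallb => i.
    rewrite !inE ltnS leq_eqVlt.
    case: (boolP (i \in D)) => //= iD; case: eqP => //= ij.
    by case/negP: oD; suff <- : i = o by []; apply/val_inj.
  have DE : Dj j.+1 = o |: Dj j.
    apply/setP=> i; rewrite !inE ltnS leq_eqVlt -(inj_eq val_inj) /=.
    case: eqP => [ij|_] //=.
    have -> : i = o by apply/val_inj.
    by rewrite oD.
  have oN : o \notin Dj j by rewrite !inE ltnn andbF.
  rewrite DE cardsU1 oN add1n !expnS -mulnA mulnCA.
  (* Resampling coordinate [o] keeps all earlier values, hence both [F o] and the constraints in
     [P j]. *)
  pose st (f : {ffun 'I_n -> T}) v := [ffun i => if i == o then v else f i].
  have stE f v (i : 'I_n) : i < j -> st f v i = f i.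
    by move=> ij; rewrite ffunE; case: eqP => // io; rewrite io ltnn in ij.
  have step : k * #|P j.+1| <= c * #|P j|.
    apply: (@card_resample _ _ (fun f : {ffun 'I_n -> T} => f o) st _ _ (F o)).
    - by move=> f v; rewrite ffunE eqxx.
    - by move=> f v; apply/ffunP=> i; rewrite !ffunE; case: eqP => [->|].
    - move=> f v; rewrite !inE => /forall_inP h; apply/forall_inP=> i iD.
      have ij : i < j by move: iD; rewrite inE => /andP[].
      rewrite stE // (Fprev _ _ f) ?h //; last first.
        by move=> i' i'i; rewrite stE // (ltn_trans i'i).
      by rewrite DE inE iD orbT.
    - by move=> f v; apply: Fprev => i ij; rewrite stE.
    - by move=> f; rewrite inE => /forall_inP; apply; rewrite DE setU11.
    - by move=> f _; apply: cF.
  apply: leq_trans (leq_mul (leqnn _) step) _.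
  by rewrite mulnCA -mulnA leq_mul2l IHj orbT.
have DnE : Dj n = D by apply/setP=> i; rewrite inE ltn_ord andbT.
by have := main n (leqnn _); rewrite /P DnE.
Qed.

(** Coordinates are independent: the count is a product with factor [#|U j|] on [D] and [#|T|]
    elsewhere. *)
Lemma card_ffun_constrained_weighted (A T : finType) (D : {set A})
    (U : A -> {set T}) (k c : nat) :
  (forall j, j \in D -> k * #|U j| <= c * #|T|) ->
  k ^ #|D| * #|[set f : {ffun A -> T} | [forall j in D, f j \in U j]]|
    <= c ^ #|D| * #|T| ^ #|A|.
Proof.
move=> cU; pose U' j : {set T} := if j \in D then U j else setT.
have -> : #|[set f : {ffun A -> T} | [forall j in D, f j \in U j]]|
    = \prod_j #|U' j|.
  under [RHS]eq_bigr => j _ do rewrite -sum1_card big_mkcond /=.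
  rewrite bigA_distr_bigA /= -sum1dep_card big_mkcond /=.
  apply: eq_bigr => f _; case: forall_inP => [h|h].
    rewrite big1 // => j _; rewrite /U'; case: (boolP (j \in D)) => jD.
      by rewrite h.
    by rewrite in_setT.
  have [j jD jU] : exists2 j, j \in D & f j \notin U j.
    by apply/exists_inP; rewrite -negb_forall_in; apply/negP => /forall_inP.
  by rewrite (bigD1 j) //= /U' jD (negbTE jU) mul0n.
rewrite -!prod_nat_const !(big_mkcond (mem D)) /= -!big_split /=.
apply: leq_prod => j _; rewrite /U'; case: ifP => jD; first exact: cU.
by rewrite cardsT.
Qed.

Lemma card_ffun_constrained (A T : finType) (D : {set A}) (U : A -> {set T})
    (k c e : nat) :
  0 < c -> 0 < k -> e <= #|D| ->
  (forall j, j \in D -> k * #|U j| <= c * #|T|) ->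
  k ^ e * #|[set f : {ffun A -> T} | [forall j in D, f j \in U j]]|
    <= c ^ #|A| * #|T| ^ #|A|.
Proof.
move=> c_gt0 k_gt0 eD cU.
apply: leq_trans (leq_trans (card_ffun_constrained_weighted cU) _).
  by rewrite leq_mul2r leq_pexp2l ?orbT.
by rewrite leq_mul2r leq_pexp2l ?orbT // max_card.
Qed.

Lemma card_ffun_constrained1 (A T : finType) (D : {set A})
    (U : A -> {set T}) (k e : nat) :
  0 < k -> e <= #|D| -> (forall j, j \in D -> k * #|U j| <= #|T|) ->
  k ^ e * #|[set f : {ffun A -> T} | [forall j in D, f j \in U j]]|
    <= #|T| ^ #|A|.
Proof.
move=> k_gt0 eD cU; rewrite -[leqRHS]mul1n -[X in _ <= X * _](exp1n #|A|).
by apply: card_ffun_constrained => // j jD; rewrite mul1n cU.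
Qed.

(** * Graphs without bipartite holes *)

Lemma card_sum_sections1 (X Y : finType) (P : {set X * Y}) :
  #|P| = \sum_x #|[set y | (x, y) \in P]|.
Proof.
rewrite -sum1_card (eq_bigl (fun z => (true && ((z.1, z.2) \in P)))); last first.
  by case=> x y.
rewrite -(pair_big_dep predT (fun x y => (x, y) \in P) (fun _ _ => 1)).
apply: eq_bigr => x _; rewrite -sum1_card; apply: eq_bigl => y; by rewrite inE.
Qed.

Lemma card_sum_sections2 (X Y : finType) (P : {set X * Y}) :
  #|P| = \sum_y #|[set x | (x, y) \in P]|.
Proof.
rewrite card_sum_sections1 (eq_bigr (fun x => \sum_y ((x, y) \in P))).
  rewrite exchange_big; apply: eq_bigr => y _ /=.
  by rewrite -sum1dep_card [RHS]big_mkcond /=; apply: eq_bigr => x _; case: (_ \in _).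
move=> x _.
by rewrite -sum1dep_card [LHS]big_mkcond /=; apply: eq_bigr => y _; case: (_ \in _).
Qed.

Lemma sum_threshold_le (X : finType) (K : {set X}) (f : X -> nat) a b :
  (forall x, x \in K -> f x <= a) -> (forall x, x \notin K -> f x <= b) ->
  \sum_x f x <= #|K| * a + #|X| * b.
Proof.
move=> fa fb; rewrite (bigID (mem K)) /=; apply: leq_add.
  by rewrite -sum_nat_const; apply: leq_sum.
rewrite -sum_nat_const [leqRHS](bigID (mem K)) /=.
by apply: leq_trans (leq_addl _ _); apply: leq_sum.
Qed.

(** Absence of bipartite holes of size [s], where the two sets may overlap or coincide. *)
Definition bi_dense (L : finType) (e : rel L) (s : nat) : Prop :=
  forall S T : {set L}, s <= #|S| -> s <= #|T| ->
    exists x y, [/\ x \in S, y \in T & e x y].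

Lemma bi_dense_gt0 (L : finType) (e : rel L) s : bi_dense e s -> 0 < s.
Proof.
move=> eD; case: (posnP s) => // s0.
have [||x [y []]] := eD set0 set0; rewrite ?s0 //.
by rewrite inE.
Qed.

Lemma card_no_neighbour (L : finType) (e : rel L) s (T : {set L}) :
  bi_dense e s -> s <= #|T| -> #|[set x | [forall y in T, ~~ e x y]]| < s.
Proof.
move=> eD sT; rewrite ltnNge; apply/negP => /eD /(_ sT) [x [y []]].
by rewrite inE => /forall_inP h /h /negP.
Qed.

(** At least [2 s] first coordinates [x] carry [s] or more second coordinates in [W]. Apart from at
    most [2 s] exceptional values [k] of [h.2], at least [s] of these [x] have a neighbour of [k]
    above them, and [h.1] must avoid all such [x], which leaves fewer than [s] choices. *)
Lemma card_avoid_large (L : finType) (e : rel L) s (W : {set L * L}) :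
  bi_dense e s -> 3 * s * #|L| <= #|W| ->
  #|[set h : L * L | [forall x in W, ~~ (e h.1 x.1 && e h.2 x.2)]]|
    <= 3 * s * #|L|.
Proof.
move=> eD Wbig; set m := #|L| in Wbig *.
set B := [set h : L * L | _].
have s_gt0 := bi_dense_gt0 eD.
have [m0|m_gt0] := posnP m.
  apply: leq_trans (max_card _) _.
  by rewrite card_prod -/m m0.
pose Wx x := [set y | (x, y) \in W].
pose X := [set x | s <= #|Wx x|].
have X2s : 2 * s <= #|X|.
  have : #|W| <= #|X| * m + m * s.
    rewrite card_sum_sections1; apply: sum_threshold_le => x.
      by move=> _; apply: max_card.
    by rewrite inE -ltnNge => /ltnW.
  nia.
pose Xk k := [set x in X | ~~ [forall y in Wx x, ~~ e k y]].
pose K := [set k | #|Xk k| < s].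
(* Double counting of [Z]: each [x] in [X] meets fewer than [s] values [k] in [Z], each [k] in [K]
   at least [#|X| - s] values [x]; then [2 s <= #|X|] gives the bound. *)
have cK : #|K| <= 2 * s.
  pose Z := [set z : L * L | (z.1 \in X) && [forall y in Wx z.1, ~~ e z.2 y]].
  have Zle : #|Z| <= #|X| * s.
    rewrite card_sum_sections1.
    suff : \sum_x #|[set y | (x, y) \in Z]| <= #|X| * s + #|L| * 0.
      by rewrite muln0 addn0.
    apply: sum_threshold_le => x xX.
      have xs : s <= #|Wx x| by move: xX; rewrite inE.
      apply: leq_trans (ltnW (card_no_neighbour eD xs)).
      by apply/subset_leq_card/subsetP => k; rewrite !inE => /andP[].
    rewrite leqn0 cards_eq0; apply/eqP/setP => k.
    by rewrite [LHS]inE [LHS]inE /= (negbTE xX) inE.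
  have Zge : #|K| * (#|X| - s) <= #|Z|.
    rewrite card_sum_sections2 -sum_nat_const [leqRHS](bigID (mem K)) /=.
    apply: leq_trans (leq_addr _ _); apply: leq_sum => k kK.
    have -> : [set x | (x, k) \in Z] = X :\: Xk k.
      apply/setP => x; rewrite !inE /=.
      by case: (s <= _); rewrite ?andbF //= negbK andbT.
    rewrite cardsD leq_sub2l //; move: kK; rewrite inE => /ltnW.
    by apply: leq_trans; rewrite subset_leq_card // subsetIr.
  nia.
have Ble : #|B| <= #|K| * m + m * s.
  rewrite card_sum_sections2; apply: sum_threshold_le => k.
    by move=> _; apply: max_card.
  rewrite inE -leqNgt => ks.
  apply: leq_trans (ltnW (card_no_neighbour eD ks)).
  apply/subset_leq_card/subsetP => h; rewrite !inE /= => /forall_inP hW.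
  apply/forall_inP => x; rewrite !inE => /andP[_].
  rewrite negb_forall_in => /exists_inP [y]; rewrite inE => /hW /=.
  by rewrite negb_and negbK => /orP[//|/negbTE->].
nia.
Qed.

(** * Matchings *)

Definition matching (A B : finType) (M : {set A * B}) : bool :=
  [forall z in M, forall z' in M, ((z.1 == z'.1) || (z.2 == z'.2)) ==> (z == z')].

Lemma matchingP (A B : finType) (M : {set A * B}) :
  reflect (forall z z', z \in M -> z' \in M -> z.1 = z'.1 \/ z.2 = z'.2 -> z = z')
    (matching M).
Proof.
apply: (iffP forall_inP) => [h z z' zM z'M zz'|h z zM].
  have /forall_inP /(_ z' z'M) /implyP := h z zM.
  by move=> h'; apply/eqP/h'; case: zz' => ->; rewrite eqxx ?orbT.
apply/forall_inP => z' z'M; apply/implyP => zz'; apply/eqP/h => //.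
by case/orP: zz' => /eqP; [left|right].
Qed.

Lemma matchingS (A B : finType) (M M' : {set A * B}) :
  M' \subset M -> matching M -> matching M'.
Proof.
move=> /subsetP s /matchingP h; apply/matchingP => z z' /s zM /s; exact: h.
Qed.

(** Distinct pairs of a matching share no coordinate, so the values at them are independent; the
    induction resamples both coordinates of one pair at a time. *)
Lemma card_pair_ffun_matching (A B L : finType) (M : {set A * B})
    (U : A * B -> {set L * L}) k :
  matching M -> (forall z, z \in M -> k * #|U z| <= #|L| ^ 2) ->
  k ^ #|M| *
    #|[set f : {ffun A -> L} * {ffun B -> L} |
        [forall z in M, (f.1 z.1, f.2 z.2) \in U z]]|
    <= #|{: {ffun A -> L} * {ffun B -> L}}|.
Proof.
move: {2}#|M| (erefl #|M|) => l; elim: l M => [|l IH] M cM mM cU.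
  by rewrite cM mul1n max_card.
have /card_gt0P [z zM] : 0 < #|M| by rewrite cM.
pose M' := M :\ z.
have cM' : #|M'| = l by have := cardsD1 z M; rewrite zM cM; case.
have M'M : M' \subset M by apply: subsetDl.
have {}IH := IH M' cM' (matchingS M'M mM) (fun w wM' => cU w (subsetP M'M w wM')).
rewrite cM' in IH; rewrite cM expnSr -mulnA; apply: leq_trans IH.
rewrite leq_mul2l; apply/orP; right.
pose st (f : {ffun A -> L} * {ffun B -> L}) (v : L * L) :=
  ([ffun a => if a == z.1 then v.1 else f.1 a],
   [ffun b => if b == z.2 then v.2 else f.2 b]).
rewrite -[leqRHS]mul1n.
refine (@card_resample _ (L * L)%type
  (fun f : {ffun A -> L} * {ffun B -> L} => (f.1 z.1, f.2 z.2)) st _ _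
  (fun _ => U z) k 1 _ _ _ _ _ _) => //.
- by move=> f [v v']; rewrite /= !ffunE !eqxx.
- by move=> [f f'] v; congr pair; apply/ffunP => i; rewrite !ffunE /=; case: eqP => // ->.
- move=> f v; rewrite !inE => /forall_inP h; apply/forall_inP => w.
  rewrite in_setD1 => /andP[wz wM]; rewrite /= !ffunE.
  case: eqP => [e1|_].
    by move/matchingP: mM => /(_ w z wM zM (or_introl e1)) e; rewrite e eqxx in wz.
  case: eqP => [e2|_]; last exact: h.
  by move/matchingP: mM => /(_ w z wM zM (or_intror e2)) e; rewrite e eqxx in wz.
- by move=> f; rewrite inE => /forall_inP; apply.
- by move=> f _; rewrite mul1n card_prod; apply: cU.
Qed.

(** * Typical pairs of labellings *)

Lemma card_set_type (T : finType) : #|{: {set T}}| = 2 ^ #|T|.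
Proof. by rewrite -[LHS]cardsT -powersetT card_powerset cardsT. Qed.

Definition concentrated (L : finType) n u s (z : {ffun 'I_n -> L}) : bool :=
  [exists D : {set 'I_n}, exists U : {set L},
    [&& u <= #|D|, #|U| < s & [forall a in D, z a \in U]]].

(** Union bound over the witnesses [D] and [U]: each of the [u] indices falls into [U] with
    probability at most [s / #|L| <= 1 / k]. *)
Lemma card_concentrated (L : finType) n u s k :
  0 < k -> k * s <= #|L| ->
  k ^ u * #|[set z : {ffun 'I_n -> L} | concentrated u s z]|
    <= 2 ^ (n + #|L|) * #|L| ^ n.
Proof.
move=> k_gt0 ks.
pose Y (i : {set 'I_n} * {set L}) : {set {ffun 'I_n -> L}} :=
  if (u <= #|i.1|) && (#|i.2| < s)
  then [set z : {ffun 'I_n -> L} | [forall a in i.1, z a \in i.2]] else set0.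
have -> : 2 ^ (n + #|L|) = #|{: {set 'I_n} * {set L}}|.
  by rewrite card_prod !card_set_type card_ord expnD.
apply: (card_union_bound (Y := Y)) => [z|[D U]].
  rewrite inE => /existsP[D /existsP[U /and3P[uD Us h]]]; exists (D, U).
  by rewrite /Y /= uD Us inE.
rewrite /Y /=; case: ifP => [/andP[uD Us]|_]; last by rewrite cards0 muln0.
rewrite -[X in _ <= _ ^ X](card_ord n).
apply: (card_ffun_constrained1 (U := fun _ => U)) => // _ _; apply: leq_trans ks.
by rewrite leq_mul2l (ltnW Us) orbT.
Qed.

(** Labels taken at most [r] times account for at most [#|L| * r] indices. If fewer than [s] labels
    were more popular, the remaining [u] indices would make [z] concentrated. *)
Lemma card_popular_values (L : finType) n u s r (z : {ffun 'I_n -> L})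
    (D : {set 'I_n}) :
  ~~ concentrated u s z -> u + #|L| * r <= #|D| ->
  s <= #|[set h | r < #|[set a in D | z a == h]|]|.
Proof.
move=> zN uD; rewrite leqNgt; apply/negP; set U := [set h | _] => Us.
case/negP: zN; apply/existsP; exists [set a in D | z a \in U].
apply/existsP; exists U; rewrite Us /=; apply/andP; split; last first.
  by apply/forall_inP => a; rewrite inE => /andP[].
rewrite -(leq_add2r (#|L| * r)); apply: leq_trans uD _.
rewrite -(cardsID [set a | z a \in U] D) leq_add //.
  by rewrite subset_leq_card //; apply/subsetP => a; rewrite !inE.
have := @card_union_bound _ L (D :\: [set a | z a \in U])
  (fun h => [set a in D | (z a == h) && (h \notin U)]) 1 r.
rewrite mul1n; apply.
  by move=> a; rewrite !inE => /andP[aU aD]; exists (z a); rewrite !inE aD eqxx.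
move=> h; rewrite mul1n; case: (boolP (h \in U)) => hU.
  rewrite (_ : [set a in D | _] = set0) ?cards0 //.
  by apply/setP => a; rewrite !inE !andbF.
rewrite (_ : [set a in D | _] = [set a in D | z a == h]); last first.
  by apply/setP => a; rewrite !inE andbT.
by move: hU; rewrite inE -leqNgt.
Qed.

Definition crossing (L : finType) (e : rel L) n
    (t : {ffun 'I_n -> L} * {ffun 'I_n -> L}) : {set 'I_n * 'I_n} :=
  [set z | e (t.1 z.1) (t.2 z.2)].

(* Strict excess over [r] survives the removal of [r] matchings. *)
Definition typical (L : finType) (e : rel L) n u r (Q : {set 'I_n * 'I_n})
    (t : {ffun 'I_n -> L} * {ffun 'I_n -> L}) : bool :=
  [forall A' : {set 'I_n}, forall B' : {set 'I_n},
    (u <= #|A'|) && (u <= #|B'|) ==>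
    [exists b in B', exists h, e h (t.2 b) &&
      (r < #|[set a in A' | (t.1 a == h) && ((a, b) \notin Q)]|)]].

(** Reveal [t.1] first; it is rarely concentrated. If it is not, then for fixed [A'], [B'] many [b]
    in [B'] see at least [s] popular labels on [A'], and atypicality forces [t.2 b] to have no
    neighbour among them. *)
Lemma card_atypical (L : finType) (e : rel L) n q s k r (Q : {set 'I_n * 'I_n}) :
  n = 64 * q -> symmetric e -> bi_dense e s -> 0 < k -> k * s <= #|L| ->
  #|L| <= n -> #|L| * r <= 16 * q -> #|Q| < 64 * q ^ 2 ->
  k ^ (32 * q) * #|[set t | ~~ typical e (56 * q) r Q t]|
    <= 8 ^ n * #|{: {ffun 'I_n -> L} * {ffun 'I_n -> L}}|.
Proof.
move=> nE eS eD k_gt0 ks mn mr cQ; set m := #|L| in ks mn mr.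
pose T := ({ffun 'I_n -> L} * {ffun 'I_n -> L})%type.
set X := [set t | _].
pose X1 : {set T} := [set t : T | concentrated (32 * q) s t.1].
pose X2 : {set T} := X :\: X1.
have q_gt0 : 0 < q by case: (q) cQ => //; rewrite ltn0.
have cT : #|{: T}| = m ^ n * m ^ n by rewrite card_prod card_ffun card_ord.
have h1 : k ^ (32 * q) * #|X1| <= 2 ^ (n + m) * #|{: T}|.
  have -> : X1 = setX [set z : {ffun 'I_n -> L} | concentrated (32 * q) s z] setT.
    by apply/setP => t; rewrite !inE andbT.
  rewrite cardsX cardsT cT card_ffun card_ord !mulnA leq_mul2r; apply/orP; right.
  exact: card_concentrated.
have h2 : k ^ (32 * q) * #|X2| <= 4 ^ n * #|{: T}|.
  pose Y (i : {set 'I_n} * {set 'I_n}) : {set T} :=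
    if (56 * q <= #|i.1|) && (56 * q <= #|i.2|) then
    [set t : T | ~~ concentrated (32 * q) s t.1 &&
      [forall b in i.2, forall h, e h (t.2 b) ==>
      (#|[set a in i.1 | (t.1 a == h) && ((a, b) \notin Q)]| <= r)]] else set0.
  have -> : 4 ^ n = #|{: {set 'I_n} * {set 'I_n}}|.
    by rewrite card_prod !card_set_type card_ord -expnMn.
  apply: (card_union_bound (Y := Y)) => [t|[A' B']].
    rewrite !inE => /andP[tN]; rewrite negb_forall => /existsP[A'].
    rewrite negb_forall => /existsP[B']; rewrite negb_imply => /andP[cAB h].
    exists (A', B'); rewrite /Y /= cAB inE tN /=.
    apply/forall_inP => b bB; apply/forallP => x; apply/implyP => ex.
    rewrite leqNgt; apply: contra h => h; apply/exists_inP; exists b => //.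
    by apply/existsP; exists x; rewrite ex.
  rewrite /Y /=; case: ifP => [/andP[cA cB]|_]; last by rewrite cards0 muln0.
  have -> : #|{: T}| = #|{: {ffun 'I_n -> L}}| * m ^ n.
    by rewrite cT card_ffun card_ord.
  apply: card_fiber_bound => z.
  case: (boolP (concentrated (32 * q) s z)) => zN.
    rewrite (_ : [set y | _] = set0) ?cards0 ?muln0 //.
    by apply/setP => w; rewrite !inE /= zN.
  pose Qb b := [set a | (a, b) \in Q].
  pose B2 := [set b in B' | #|Qb b| < 8 * q].
  (* Since [#|Q| < 64 * q ^ 2], fewer than [8 * q] elements of [B'] have [8 * q] or more partners in
     [Q]. *)
  have cB2 : 32 * q <= #|B2|.
    have h : #|B' :\: B2| * (8 * q) <= #|Q|.
      rewrite card_sum_sections2 -sum_nat_const.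
      rewrite [leqRHS](bigID (mem (B' :\: B2))) /=.
      apply: leq_trans (leq_addr _ _); apply: leq_sum => b.
      by rewrite !inE => /andP[]; case: (b \in B'); rewrite //= -leqNgt.
    have h' := cardsID B2 B'.
    have h3 : #|B' :&: B2| <= #|B2| by rewrite subset_leq_card // subsetIr.
    have h4 : #|B' :\: B2| < 8 * q.
      rewrite -(ltn_pmul2r (m := 8 * q)) ?muln_gt0 //; apply: leq_ltn_trans h _.
      by rewrite mulnACA mulnn.
    move: h' h3 h4 cB; move: #|B' :\: B2| #|B' :&: B2| #|B'| #|B2|; lia.
  (* Removing [Qb b] leaves at least [48 * q] elements of [A'], which covers the [32 * q] of
     concentration plus [#|L| * r <= 16 * q]. *)
  pose hv b := [set x | r < #|[set a in A' :\: Qb b | z a == x]|].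
  have chv b : b \in B2 -> s <= #|hv b|.
    rewrite inE => /andP[_ bQ]; apply: card_popular_values zN _.
    have h' := cardsID (Qb b) A'.
    have h3 : #|A' :&: Qb b| <= #|Qb b| by rewrite subset_leq_card // subsetIr.
    move: h' h3 bQ cA mr; rewrite -/m.
    move: #|A' :&: Qb b| #|A' :\: Qb b| #|A'| #|Qb b| (m * r); lia.
  pose U b := [set y | [forall x in hv b, ~~ e y x]].
  rewrite -[X in _ <= _ ^ X](card_ord n).
  apply: leq_trans (card_ffun_constrained1 (U := U) k_gt0 cB2 _).
    rewrite leq_mul2l; apply/orP; right; apply/subset_leq_card/subsetP => w.
    rewrite !inE /= => /andP[_ /forall_inP hw]; apply/forall_inP => b bB2.
    have bB : b \in B' by move: bB2; rewrite inE => /andP[].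
    rewrite inE; apply/forall_inP => x; rewrite inE ltnNge; apply: contra => ex.
    move/forallP: (hw b bB) => /(_ x); rewrite eS ex /=.
    apply: leq_trans; apply/subset_leq_card/subsetP => a.
    by rewrite !inE => /andP[/andP[-> ->] ->].
  move=> b bB2; apply: leq_trans ks.
  by rewrite leq_mul2l (ltnW (card_no_neighbour eD (chv b bB2))) orbT.
have hX : #|X| <= #|X1| + #|X2|.
  rewrite -(cardsID X1 X) leq_add2r subset_leq_card //; exact: subsetIr.
apply: leq_trans (leq_mul (leqnn _) hX) _; rewrite mulnDr.
apply: leq_trans (leq_add h1 h2) _; rewrite -mulnDl leq_mul2r; apply/orP; right.
have e1 : 2 ^ (n + m) <= 4 ^ n.
  by rewrite -[4]/(2 ^ 2) -expnM leq_exp2l // mulSn mul1n leq_add2l.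
have e2 : 2 <= 2 ^ n by rewrite -{1}(expn1 2) leq_exp2l // nE; lia.
have -> : 8 ^ n = 2 ^ n * 4 ^ n by rewrite -expnMn.
nia.
Qed.

(** Greedy choice: each new matching is a maximal one avoiding [Q] and the earlier matchings. Were
    it smaller than [8 * q], at least [56 * q] vertices on each side would be unmatched, and
    typicality would supply a pair extending it. *)
Lemma typical_disjoint_matchings (L : finType) (e : rel L) n q r
    (Q : {set 'I_n * 'I_n}) (t : {ffun 'I_n -> L} * {ffun 'I_n -> L}) :
  n = 64 * q -> typical e (56 * q) r Q t ->
  exists M : 'I_r -> {set 'I_n * 'I_n},
    [/\ forall i, matching (M i), forall i, 8 * q <= #|M i|,
        forall i, M i \subset crossing e t :\: Q
      & forall i j, i != j -> [disjoint M i & M j]].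
Proof.
move=> nE tT; pose G := crossing e t :\: Q.
suff main : forall l, l <= r -> exists M : nat -> {set 'I_n * 'I_n},
    [/\ forall i, i < l -> matching (M i), forall i, i < l -> 8 * q <= #|M i|,
        forall i, i < l -> M i \subset G
      & forall i j, i < l -> j < l -> i != j -> [disjoint M i & M j]].
  have [M [h1 h2 h3 h4]] := main r (leqnn _).
  by exists (fun i => M i); split=> *; auto.
elim=> [|l IH] lr; first by exists (fun _ => set0).
have [M [h1 h2 h3 h4]] := IH (ltnW lr).
pose R := \bigcup_(i < l) M i.
pose p := [pred N : {set 'I_n * 'I_n} | matching N && (N \subset G :\: R)].
have p0 : p set0.
  rewrite /= sub0set andbT; apply/matchingP => z z'; by rewrite inE.
have [N /maxsetP [/andP[mN NG] maxN] _] := maxset_exists p0.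
have cN : 8 * q <= #|N|.
  rewrite leqNgt; apply/negP => Nq.
  pose A' := ~: [set z.1 | z in N]; pose B' := ~: [set z.2 | z in N].
  have cA : 56 * q <= #|A'|.
    have := cardsC [set z.1 | z in N]; rewrite -/A' card_ord.
    have := leq_imset_card (fun z : 'I_n * 'I_n => z.1) (mem N).
    by move: Nq nE; move: #|A'| #|N| #|[set z.1 | z in N]|; lia.
  have cB : 56 * q <= #|B'|.
    have := cardsC [set z.2 | z in N]; rewrite -/B' card_ord.
    have := leq_imset_card (fun z : 'I_n * 'I_n => z.2) (mem N).
    by move: Nq nE; move: #|B'| #|N| #|[set z.2 | z in N]|; lia.
  move/forallP: tT => /(_ A') /forallP /(_ B'); rewrite cA cB /=.
  case/exists_inP => b bB /existsP[h /andP[eh]].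
  set S := [set a in A' | _] => rS.
  (* Each of the [l < r] earlier matchings contains at most one pair ending in [b], so some of the
     more than [r] candidates survive. *)
  have /card_gt0P [a] : 0 < #|S :\: [set a | (a, b) \in R]|.
    rewrite cardsD subn_gt0; apply: leq_ltn_trans rS.
    apply: leq_trans (ltnW lr).
    have := @card_union_bound _ 'I_l (S :&: [set a | (a, b) \in R])
      (fun i => [set a | (a, b) \in M i]) 1 1.
    rewrite mul1n muln1 card_ord; apply.
      move=> a; rewrite !inE => /andP[_ /bigcupP[i _ ai]]; exists i.
      by rewrite inE.
    move=> i; rewrite mul1n; apply/card_le1_eqP => a a'; rewrite !inE => aM a'M.
    have /matchingP /(_ _ _ aM a'M (or_intror erefl)) := h1 i (ltn_ord i).
    by case.
  rewrite !inE => /andP[abR /andP[aN /andP[/eqP ta abQ]]].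
  have abG : (a, b) \in G :\: R by rewrite !inE abR abQ /= ta.
  have abN : (a, b) \notin N.
    apply: contra aN => abN; apply/imsetP; by exists (a, b).
  have := maxN ((a, b) |: N) _ (subsetUr _ _).
  move=> E; case/negP: abN; rewrite -E ?setU11 //=.
  rewrite subUset sub1set abG NG !andbT.
  apply/matchingP => z z'; rewrite !inE => /orP[/eqP->|zN] /orP[/eqP->|z'N] //=.
  - case=> zz'.
      by case/negP: aN; apply/imsetP; exists z'.
    by move: bB; rewrite !inE => /negP[]; apply/imsetP; exists z'.
  - case=> zz'.
      by case/negP: aN; apply/imsetP; exists z.
    by move: bB; rewrite !inE => /negP[]; apply/imsetP; exists z.
  - by move/matchingP: mN; apply.
exists (fun i => if i == l then N else M i); split=> [i|i|i|i j].
- by rewrite ltnS leq_eqVlt; case: eqP => //= _; apply: h1.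
- by rewrite ltnS leq_eqVlt; case: eqP => //= _; apply: h2.
- rewrite ltnS leq_eqVlt; case: eqP => //= _; last exact: h3.
  by move=> _; apply: subset_trans NG _; apply: subsetDl.
have NM j' : j' < l -> [disjoint N & M j'].
  move=> jl; rewrite -setI_eq0; apply/eqP/setP => z; rewrite !inE.
  apply/negbTE/negP => /andP[/(subsetP NG)]; rewrite inE => /andP[zR _] zM.
  by case/negP: zR; apply/bigcupP; exists (Ordinal jl).
rewrite !ltnS [i <= l]leq_eqVlt [j <= l]leq_eqVlt.
case: eqP => [->|_]; case: eqP => [->|_] //=.
- by rewrite eqxx.
- by move=> _ jl _; apply: NM.
- by move=> il _ _; rewrite disjoint_sym; apply: NM.
- exact: h4.
Qed.

(** * Revealing labels one vertex at a time *)

Local Notation ffun2 n L := ({ffun 'I_n -> L} * {ffun 'I_n -> L})%type.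

Definition value2 (L : finType) n (t : ffun2 n L) (z : 'I_n * 'I_n) : L * L :=
  (t.1 z.1, t.2 z.2).

(* [W_ab] with [z = (a, b)], restricted to the elements of [C] before [j]. *)
Definition seen (L : finType) (e : rel L) n (tau xi : {ffun 'I_n -> ffun2 n L})
    (j : nat) (z : 'I_n * 'I_n) : {set L * L} :=
  [set value2 (xi c) z | c in [set c : 'I_n | (c < j) && (z \in crossing e (tau c))]].

Definition fresh (L : finType) (e : rel L) n (tau xi : {ffun 'I_n -> ffun2 n L})
    (c : 'I_n) : {set 'I_n * 'I_n} :=
  [set z in crossing e (tau c) | value2 (xi c) z \notin seen e tau xi c z].

Lemma seenS (L : finType) (e : rel L) n (tau xi : {ffun 'I_n -> ffun2 n L}) i j z :
  i <= j -> seen e tau xi i z \subset seen e tau xi j z.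
Proof.
move=> ij; apply: imsetS; apply/subsetP => c; rewrite !inE => /andP[ci ->].
by rewrite (leq_trans ci).
Qed.

(* A pair is fresh at most once for each of the [#|L| ^ 2] possible values. *)
Lemma sum_card_fresh (L : finType) (e : rel L) n
    (tau xi : {ffun 'I_n -> ffun2 n L}) :
  \sum_c #|fresh e tau xi c| <= n ^ 2 * #|L| ^ 2.
Proof.
pose Z := [set u : 'I_n * ('I_n * 'I_n) | u.2 \in fresh e tau xi u.1].
have -> : \sum_c #|fresh e tau xi c| = #|Z|.
  rewrite card_sum_sections1; apply: eq_bigr => c _; congr #|pred_of_set _|.
  by apply/setP => z; rewrite [RHS]inE [RHS]inE.
rewrite card_sum_sections2.
have -> : n ^ 2 * #|L| ^ 2 = \sum_(z : 'I_n * 'I_n) #|L| ^ 2.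
  by rewrite sum_nat_const card_prod card_ord.
apply: leq_sum => z _.
set S := [set x | _].
have inj : {in S &, injective (fun c => value2 (xi c) z)}.
  suff W (c c' : 'I_n) : c \in S -> c' \in S -> value2 (xi c) z = value2 (xi c') z ->
      ~ c < c'.
    move=> c c' cS c'S E; apply/val_inj/eqP; case: ltngtP => // lt.
      by case: (W c c').
    by case: (W c' c).
  rewrite [c \in S]inE inE /= inE => /andP[cT _].
  rewrite inE inE /= inE => /andP[_ /negP c'N] E lt; apply: c'N.
  by rewrite -E; apply: imset_f; rewrite inE lt.
by rewrite -(card_in_imset inj) -[_ ^ 2]card_prod max_card.
Qed.

Lemma sum_card_disjointI (T : finType) r (M : 'I_r -> {set T}) (F : {set T}) :
  (forall i j, i != j -> [disjoint M i & M j]) ->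
  \sum_i #|M i :&: F| <= #|F|.
Proof.
move=> dM.
pose Z := [set u : 'I_r * T | u.2 \in M u.1 :&: F].
have -> : \sum_i #|M i :&: F| = #|Z|.
  rewrite card_sum_sections1; apply: eq_bigr => c _; congr #|pred_of_set _|.
  by apply/setP => z; rewrite [RHS]inE [RHS]inE.
rewrite card_sum_sections2.
have := @sum_threshold_le _ F (fun y => #|[set x | (x, y) \in Z]|) 1 0.
rewrite muln1 muln0 addn0; apply => z zF; last first.
  rewrite leqn0 cards_eq0; apply/eqP/setP => i.
  by rewrite !inE (negbTE zF) andbF.
apply/card_le1_eqP => i j; rewrite !inE /= => /andP[zi _] /andP[zj _].
by apply/eqP/negPn/negP => /dM /disjointFr /(_ zj); rewrite zi.
Qed.

(** Each such [xi] is assigned a code saying which [c] are used, which of the [r] matchings is taken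
    at [c], and which part of it is not fresh. For a fixed code, the constraint on [xi c] depends
    only on earlier values, so [card_sequential] applies. *)
Lemma card_seen_small (L : finType) (e : rel L) n q s k r
    (Q : {set 'I_n * 'I_n}) (tau : {ffun 'I_n -> ffun2 n L}) :
  n = 64 * q -> 0 < k -> 0 < #|L| -> k * (3 * s * #|L|) <= #|L| ^ 2 ->
  r = 64 * #|L| ^ 2 ->
  48 * q <= #|[set c | typical e (56 * q) r Q (tau c)]| ->
  (k ^ (4 * q)) ^ (32 * q) *
    #|[set xi : {ffun 'I_n -> ffun2 n L} |
        [forall z in ~: Q, #|seen e tau xi n z| < 3 * s * #|L|]]|
    <= 2 ^ n * (r ^ n * (2 ^ n) ^ n) * #|{: ffun2 n L}| ^ n.
Proof.
move=> nE k_gt0 m_gt0 ks rE.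
set D0 := [set c | _] => cD0.
have r_gt0 : 0 < r by rewrite rE muln_gt0 expn_gt0 m_gt0.
have exM (c : 'I_n) : exists M : 'I_r -> {set 'I_n * 'I_n}, c \in D0 ->
    [/\ forall i, matching (M i), forall i, 8 * q <= #|M i|,
        forall i, M i \subset crossing e (tau c) :\: Q
      & forall i j, i != j -> [disjoint M i & M j]].
  case: (boolP (c \in D0)) => [|_]; last by exists (fun _ => set0).
  by rewrite inE => /(typical_disjoint_matchings nE) [M hM]; exists M.
have [M hM] := fin_all_exists exM.
(* A subset of a matching is determined by its first coordinates, so it costs only [2 ^ n]
   choices. *)
pose I := ({set 'I_n} * ({ffun 'I_n -> 'I_r} * {ffun 'I_n -> {set 'I_n}}))%type.
pose Mi (i : I) c := [set z in M c (i.2.1 c) | z.1 \in i.2.2 c].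
(* The size conditions are tested inside [F], with default [set0], so that the bound on
   [#|F i c xi|] holds for every [xi] and every code. *)
pose F (i : I) (c : 'I_n) (xi : {ffun 'I_n -> ffun2 n L}) : {set ffun2 n L} :=
  if [&& 4 * q <= #|Mi i c|, matching (Mi i c) &
        [forall z in Mi i c, #|seen e tau xi c z| <= 3 * s * #|L|]]
  then [set t : ffun2 n L |
         [forall z in Mi i c, (t.1 z.1, t.2 z.2) \in seen e tau xi c z]]
  else set0.
pose Y (i : I) : {set {ffun 'I_n -> ffun2 n L}} :=
  if 32 * q <= #|i.1|
  then [set xi : {ffun 'I_n -> ffun2 n L} | [forall c in i.1, xi c \in F i c xi]]
  else set0.
have -> : 2 ^ n * (r ^ n * (2 ^ n) ^ n) = #|{: I}|.
  by rewrite !card_prod !card_ffun !card_set_type !card_ord.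
apply: (card_union_bound (Y := Y)) => [xi|i]; last first.
  rewrite /Y; case: ifP => iq; last by rewrite cards0 muln0.
  apply: (@leq_trans ((k ^ (4 * q)) ^ #|i.1| *
    #|[set xi : {ffun 'I_n -> ffun2 n L} | [forall c in i.1, xi c \in F i c xi]]|)).
    by rewrite leq_mul2r leq_pexp2l ?orbT // expn_gt0 k_gt0.
  rewrite -[leqRHS]mul1n -[X in _ <= X * _](exp1n n).
  apply: card_sequential => // [j f f' ff'|j f _].
    have sE z : seen e tau f j z = seen e tau f' j z.
      by apply: eq_in_imset => c; rewrite inE => /andP[cj _]; rewrite ff'.
    rewrite /F; under eq_forallb => z do rewrite sE.
    case: ifP => // _; apply/setP => t; rewrite !inE; apply: eq_forallb => z.
    by rewrite sE.
  rewrite mul1n /F; case: ifP => [/and3P[c1 c2 /forall_inP c3]|_]; last first.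
    by rewrite cards0 muln0.
  apply: leq_trans (card_pair_ffun_matching (k := k)
    (U := fun z => seen e tau f j z) c2 _).
    by rewrite leq_mul2r leq_pexp2l ?orbT.
  by move=> z zM; apply: leq_trans ks; rewrite leq_mul2l c3 ?orbT.
rewrite inE => /forall_inP hxi.
(* The total number of fresh pairs is at most [n ^ 2 * #|L| ^ 2], so at most [n / 4 = 16 * q] of the
   [c] exceed four times the average bound. *)
pose D := [set c in D0 | #|fresh e tau xi c| <= 4 * #|L| ^ 2 * n].
have cD : 32 * q <= #|D|.
  have h : #|D0 :\: D| * (4 * #|L| ^ 2 * n) <= n ^ 2 * #|L| ^ 2.
    apply: leq_trans (sum_card_fresh e tau xi).
    rewrite -sum_nat_const [leqRHS](bigID (mem (D0 :\: D))) /=.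
    apply: leq_trans (leq_addr _ _); apply: leq_sum => c.
    rewrite in_setD [c \in D]inE => /andP[]; case: (c \in D0) => //=.
    by rewrite -ltnNge => /ltnW.
  have h' := cardsID D D0.
  have h3 : #|D0 :&: D| <= #|D| by rewrite subset_leq_card // subsetIr.
  have h4 : #|D0 :\: D| <= 16 * q.
    have [q0|q_gt0] := posnP q.
      by apply: leq_trans (max_card _) _; rewrite card_ord nE q0.
    have mn : 0 < 4 * #|L| ^ 2 * n by rewrite !muln_gt0 m_gt0 nE; lia.
    rewrite -(leq_pmul2r mn); apply: leq_trans h _.
    rewrite nE; move: (#|L| ^ 2) => l; lia.
  move: h' h3 h4 cD0; move: #|D0 :&: D| #|D0 :\: D| #|D0| #|D|; lia.
(* The [r = 64 * #|L| ^ 2] disjoint matchings share at most [4 * #|L| ^ 2 * n] fresh pairs, so some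
   matching has at most [n / 16 = 4 * q], half of its guaranteed size. *)
have exi c : exists i : 'I_r, c \in D -> #|M c i :&: fresh e tau xi c| <= 4 * q.
  case: (boolP (c \in D)) => [|_]; last by exists (Ordinal r_gt0).
  rewrite inE => /andP[cD0' cf].
  have [_ _ _ dM] := hM c cD0'.
  have sM := leq_trans (sum_card_disjointI (fresh e tau xi c) dM) cf.
  case: (pickP (fun i => #|M c i :&: fresh e tau xi c| <= 4 * q)) => [i ci|no].
    by exists i.
  have : \sum_(i < r) (4 * q).+1 <= 4 * #|L| ^ 2 * n.
    by apply: leq_trans sM; apply: leq_sum => i _; rewrite ltnNge no.
  rewrite sum_nat_const card_ord => h; exfalso; move: h; rewrite rE nE.
  have : 0 < #|L| ^ 2 by rewrite expn_gt0 m_gt0.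
  move: (#|L| ^ 2) => l; lia.
have [io hio] := fin_all_exists exi.
pose S c := [set z.1 | z in M c (io c) :\: fresh e tau xi c].
exists (D, ([ffun c => io c], [ffun c => S c])).
rewrite /Y /= cD inE; apply/forall_inP => c cDD; rewrite /F.
have cD0' : c \in D0 by move: cDD; rewrite inE => /andP[].
have [mM bM sM dM] := hM c cD0'.
have -> : Mi (D, ([ffun c => io c], [ffun c => S c])) c
    = M c (io c) :\: fresh e tau xi c.
  apply/setP => z; rewrite [LHS]inE !ffunE [RHS]inE /=.
  apply/andP/andP => [[zM]|[zN zM]]; last first.
    by split=> //; apply/imsetP; exists z => //; rewrite in_setD zN.
  case/imsetP => z'; rewrite in_setD => /andP[z'N z'M] E.
  split=> //; have /matchingP := mM (io c).
  by move/(_ z z' zM z'M (or_introl E)) => ->.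
have c1 : 4 * q <= #|M c (io c) :\: fresh e tau xi c|.
  have := hio c cDD; have := bM (io c).
  have := cardsID (fresh e tau xi c) (M c (io c)).
  by move: #|_ :\: _| #|_ :&: _| #|M c (io c)|; lia.
rewrite c1 (matchingS (subsetDl _ _) (mM (io c))) /=.
have sQ z : z \in M c (io c) :\: fresh e tau xi c -> z \in ~: Q.
  by rewrite in_setD in_setC => /andP[_ /(subsetP (sM _))]; rewrite in_setD => /andP[].
rewrite ifT; last first.
  apply/forall_inP => z /sQ /hxi /ltnW; apply: leq_trans.
  by rewrite subset_leq_card // seenS // ltnW.
rewrite inE; apply/forall_inP => z; rewrite in_setD => /andP[zN /(subsetP (sM _))].
rewrite in_setD => /andP[_ zc].
by move: zN; rewrite inE zc /= negbK.
Qed.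

(* For parts [A], [B], [C] the components are, in order, [chi (c, .)], [chi (., c)]
   and [(chi (a, b), chi (b, a))]. *)
Local Notation configuration n L :=
  ({ffun 'I_n -> ffun2 n L} * {ffun 'I_n -> ffun2 n L}
    * {ffun 'I_n * 'I_n -> L * L})%type.

(** With [z = (a, b)], the three conjuncts are the adjacency conditions at [a], at [b] and at
    [c]. *)
Definition edgeless (L : finType) (e : rel L) n (w : configuration n L) : bool :=
  [forall z, forall c, ~~ [&& e (w.2 z).1 ((w.1.2 c).1 z.1),
    e (w.2 z).2 ((w.1.2 c).2 z.2) & z \in crossing e (w.1.1 c)]].

Lemma card_edgeless (L : finType) (e : rel L) n q s k :
  n = 64 * q -> 0 < q -> symmetric e -> bi_dense e s -> 0 < k -> 0 < #|L| ->
  3 * s * k <= #|L| -> 256 * #|L| ^ 3 <= n ->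
  k ^ (64 * q ^ 2) * #|[set w : configuration n L | edgeless e w]|
    <= 2 ^ (6 * n ^ 2) * #|{: configuration n L}|.
Proof.
move=> nE q_gt0 eS eD k_gt0 m_gt0 sk mn; set m := #|L| in m_gt0 sk mn.
set X := [set w | _].
pose T := ffun2 n L.
pose TX := ({ffun 'I_n -> T} * {ffun 'I_n -> T})%type.
pose Pt := {ffun 'I_n * 'I_n -> L * L}.
pose Q (v : TX) := [set z | 3 * s * m <= #|seen e v.1 v.2 n z|].
have ks : k * s <= m by lia.
have ks3 : k * (3 * s * m) <= m ^ 2.
  by rewrite mulnA leq_mul2r; apply/orP; right; lia.
have cP : #|{: Pt}| = (m ^ 2) ^ (n ^ 2).
  by rewrite card_ffun !card_prod !card_ord.
have cTX : #|{: TX}| = #|{: T}| ^ n * #|{: T}| ^ n.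
  by rewrite card_prod !card_ffun !card_ord.
pose r := 64 * m ^ 2.
have rn : r <= n by rewrite /r; nia.
(* Many large [W_ab]: given [tau] and [xi], each pair in [Q] confines its entry of the third
   component to [3 * s * m] of the [m ^ 2] values. *)
pose X1 := [set w in X | 64 * q ^ 2 <= #|Q w.1|].
have h1 : k ^ (64 * q ^ 2) * #|X1| <= #|{: configuration n L}|.
  rewrite [leqRHS]card_prod; apply: card_fiber_bound => v.
  case: (leqP (64 * q ^ 2) #|Q v|) => [Qv|Qv]; last first.
    rewrite (_ : [set y | _] = set0) ?cards0 ?muln0 //.
    by apply/setP => w; rewrite inE inE /= leqNgt Qv andbF inE.
  pose U z := [set h : L * L | [forall x in seen e v.1 v.2 n z,
    ~~ (e h.1 x.1 && e h.2 x.2)]].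
  rewrite card_ffun.
  apply: leq_trans (card_ffun_constrained1 (U := U) k_gt0 Qv _); last first.
    move=> z; rewrite inE => zQ; rewrite card_prod; apply: leq_trans ks3.
    by rewrite leq_mul2l card_avoid_large ?orbT.
  rewrite leq_mul2l; apply/orP; right; apply/subset_leq_card/subsetP => p.
  rewrite [p \in [set y | _]]inE [_ \in X1]inE [_ \in X]inE => /andP[/forallP hp _].
  rewrite inE; apply/forall_inP => z _; rewrite inE; apply/forall_inP => x.
  case/imsetP => c; rewrite inE => /andP[_ zc] ->.
  by move/forallP: (hp z) => /(_ c) /=; rewrite zc andbT.
(* Few large [W_ab]: the value [Q0] of [Q v] is fixed by a union bound, which turns typicality into
   a condition on [tau] alone. Then either a quarter of the [tau c] are atypical, or
   [card_seen_small] bounds the choices of [xi]. *)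
pose X2 := [set v : TX | #|Q v| < 64 * q ^ 2].
have h2 : k ^ (64 * q ^ 2) * #|X2| <= 2 ^ (n ^ 2) * (2 * 2 ^ (4 * n ^ 2) * #|{: TX}|).
  pose atyp Q0 (tau : {ffun 'I_n -> T}) :=
    [set c | ~~ typical e (56 * q) r Q0 (tau c)].
  pose sm Q0 (v : TX) := [forall z in ~: Q0, #|seen e v.1 v.2 n z| < 3 * s * m].
  pose Y (Q0 : {set 'I_n * 'I_n}) : {set TX} :=
    if #|Q0| < 64 * q ^ 2 then
    [set v | 16 * q <= #|atyp Q0 v.1|] :|:
    [set v | (#|atyp Q0 v.1| < 16 * q) && sm Q0 v] else set0.
  have -> : 2 ^ (n ^ 2) = #|{: {set 'I_n * 'I_n}}|.
    by rewrite card_set_type card_prod card_ord.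
  apply: (card_union_bound (Y := Y)) => [v|Q0].
    rewrite inE => vQ; exists (Q v); rewrite /Y vQ !inE.
    case: (leqP (16 * q)) => //= _; apply/forall_inP => z.
    by rewrite !inE -ltnNge.
  rewrite /Y; case: ifP => cQ0; last by rewrite cards0 muln0.
  apply: leq_trans (leq_mul (leqnn _) (leq_of_leqif (leq_card_setU _ _))) _.
  rewrite mulnDr [2 * _]mul2n -addnn mulnDl; apply: leq_add.
    pose Y1 (D : {set 'I_n}) : {set {ffun 'I_n -> T}} :=
      if 16 * q <= #|D| then [set tau : {ffun 'I_n -> T} |
        [forall c in D, tau c \in [set t | ~~ typical e (56 * q) r Q0 t]]]
      else set0.
    have t1 : k ^ (64 * q ^ 2) *
        #|[set tau : {ffun 'I_n -> T} | 16 * q <= #|atyp Q0 tau|]|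
        <= #|{: {set 'I_n}}| * ((8 ^ n) ^ n * #|{: T}| ^ n).
      apply: (@leq_trans ((k ^ (32 * q)) ^ (16 * q) *
        #|[set tau : {ffun 'I_n -> T} | 16 * q <= #|atyp Q0 tau|]|)).
        rewrite leq_mul2r; apply/orP; right.
        by rewrite -expnM leq_pexp2l // mulnACA mulnn leq_mul2r ?orbT.
      apply: (card_union_bound (Y := Y1)) => [tau|D].
        rewrite inE => h; exists (atyp Q0 tau); rewrite /Y1 h inE.
        by apply/forall_inP => c; rewrite !inE.
      rewrite /Y1; case: ifP => cD; last by rewrite cards0 muln0.
      have := @card_ffun_constrained 'I_n T D
        (fun _ => [set t | ~~ typical e (56 * q) r Q0 t])
        (k ^ (32 * q)) (8 ^ n) (16 * q).
      rewrite card_ord; apply; rewrite ?expn_gt0 ?k_gt0 //.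
      move=> c _; apply: card_atypical eS eD k_gt0 ks _ _ cQ0 => //.
        by rewrite -/m; nia.
      by rewrite -/m /r; nia.
    have -> : [set v : TX | 16 * q <= #|atyp Q0 v.1|] =
        setX [set tau : {ffun 'I_n -> T} | 16 * q <= #|atyp Q0 tau|] setT.
      by apply/setP => v; rewrite !inE andbT.
    rewrite cardsX cardsT mulnA cTX card_ffun card_ord mulnA leq_mul2r.
    apply/orP; right; apply: leq_trans t1 _; rewrite card_set_type card_ord mulnA.
    rewrite leq_mul2r -[8]/(2 ^ 3) -!expnM -expnD leq_exp2l //.
    by apply/orP; right; nia.
  have cF : #|{: {ffun 'I_n -> T}}| = #|{: T}| ^ n by rewrite card_ffun card_ord.
  rewrite cTX mulnCA -[X in _ <= X * _]cF.
  apply: card_fiber_bound => tau.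
  case: (leqP (16 * q) #|atyp Q0 tau|) => ctau.
    rewrite (_ : [set y | _] = set0) ?cards0 ?muln0 //.
    by apply/setP => w; rewrite inE inE /= ltnNge ctau inE.
  have ctyp : 48 * q <= #|[set c | typical e (56 * q) r Q0 (tau c)]|.
    have := cardsC (atyp Q0 tau); rewrite card_ord.
    have -> : ~: atyp Q0 tau = [set c | typical e (56 * q) r Q0 (tau c)].
      by apply/setP => c; rewrite !inE negbK.
    move: ctau; move: #|atyp _ _| #|[set c | _]|; lia.
  have hZ := card_seen_small nE k_gt0 m_gt0 ks3 (erefl r) ctyp.
  apply: leq_trans (leq_trans hZ _); last first.
    rewrite leq_mul2r; apply/orP; right.
    have rn2 : r ^ n <= (2 ^ n) ^ n.
      rewrite leq_exp2r ?nE ?muln_gt0 // -nE.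
      exact: leq_trans rn (ltnW (ltn_expl n _)).
    apply: leq_trans (leq_mul (leqnn _) (leq_mul rn2 (leqnn _))) _.
    rewrite -!expnM -!expnD leq_exp2l //; nia.
  apply: leq_mul.
    by rewrite -expnM leq_pexp2l // mulnACA mulnn leq_mul2r ?orbT.
  by apply/subset_leq_card/subsetP => xi; rewrite !inE => /andP[].
pose X3 : {set configuration n L} := setX X2 setT.
have h3 : k ^ (64 * q ^ 2) * #|X3|
    <= 2 ^ (n ^ 2) * (2 * 2 ^ (4 * n ^ 2)) * #|{: configuration n L}|.
  by rewrite cardsX cardsT [#|{: configuration n L}|]card_prod !mulnA leq_mul2r
     -!mulnA (mulnA 2) h2 orbT.
have hX : #|X| <= #|X1| + #|X3|.
  apply: leq_trans (leq_of_leqif (leq_card_setU X1 X3)).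
  apply/subset_leq_card/subsetP => w wX.
  rewrite in_setU [w \in X1]inE wX /= [w \in X3]inE in_setT andbT [_ \in X2]inE.
  by case: leqP.
apply: leq_trans (leq_mul (leqnn _) hX) _; rewrite mulnDr.
apply: leq_trans (leq_add h1 h3) _.
rewrite -mulSn leq_mul2r; apply/orP; right.
rewrite mulnCA -expnD -expnS.
have -> : n ^ 2 + 4 * n ^ 2 = 5 * n ^ 2 by lia.
apply: (@leq_trans (2 ^ ((5 * n ^ 2).+2))).
  by rewrite [leqRHS]expnS mul2n -addnn -add1n leq_add2r expn_gt0.
rewrite leq_exp2l //; nia.
Qed.

(** * A random graph of large odd girth without bipartite holes *)

Lemma subset_of_card (T : finType) (A : {set T}) l :
  l <= #|A| -> exists2 B : {set T}, B \subset A & #|B| = l.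
Proof.
elim: l => [|l IH] lA; first by exists set0; rewrite ?sub0set ?cards0.
have [B BA cB] := IH (ltnW lA).
have /card_gt0P [x] : 0 < #|A :\: B|.
  by rewrite cardsD (setIidPr BA) cB subn_gt0.
rewrite in_setD => /andP[xB xA]; exists (x |: B).
  by rewrite subUset sub1set xA.
by rewrite cardsU1 xB cB.
Qed.

(** A closed walk splits at a repeated vertex into two shorter closed walks, one of which has odd
    length. *)
Lemma odd_cycle_uniq (T : eqType) (e : rel T) (s : seq T) :
  cycle e s -> odd (size s) ->
  exists s', [/\ cycle e s', odd (size s'), size s' <= size s, uniq s'
    & {subset s' <= s}].
Proof.
move: {2}(size s) (leqnn (size s)) => l; elim: l s => [|l IH] s sl cs os.
  by case: s sl cs os.
case: (boolP (uniq s)) => [us|nus]; first by exists s; split.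
have [x xs xc] : exists2 x, x \in s & count_mem x s != 1.
  apply/hasP; move: nus; apply: contraNT; rewrite -all_predC => /allP h.
  apply: count_mem_uniq => x; case: (boolP (x \in s)) => [/h /negPn /eqP //|xs].
  by apply/count_memPn.
have [i t E] := rot_to xs.
have xt : x \in t.
  rewrite -has_pred1 has_count; move: xc.
  have -> : count_mem x s = count_mem x (x :: t).
    by rewrite -E; apply/permP; rewrite perm_sym perm_rot.
  by rewrite /= eqxx; case: (count_mem x t).
have st y : y \in x :: t -> y \in s by rewrite -E mem_rot.
have ct : cycle e (x :: t) by rewrite -E rot_cycle.
have sz : size s = (size t).+1 by rewrite -(size_rot i s) E.
case/splitPr: xt st ct sz => p1 p2 st ct sz.
have [c1 c2] : cycle e (x :: p1) /\ cycle e (x :: p2).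
  move: ct; rewrite /= rcons_cat /= cat_path /= => /and3P[h1 h2 h3].
  by rewrite rcons_path h1 h2 h3.
move: sz; rewrite size_cat /= => sz.
have [o1|o1] := boolP (odd (size (x :: p1))).
  have [|s' [h1 h2 h3 h4 h5]] := IH _ _ c1 o1.
    by move: sl; rewrite sz ltnS; apply: leq_trans; rewrite addnS ltnS leq_addr.
  exists s'; split => //.
    by apply: leq_trans h3 _; rewrite /= sz ltnS leq_addr.
  move=> y /h5; rewrite inE => yp; apply: st; rewrite inE mem_cat.
  by case/orP: yp => ->; rewrite ?orbT.
have o2 : odd (size (x :: p2)).
  by move: os o1; rewrite sz /= oddD /=; case: (odd (size p1)); case: (odd (size p2)).
have [|s' [h1 h2 h3 h4 h5]] := IH _ _ c2 o2.
  by move: sl; rewrite sz ltnS; apply: leq_trans; rewrite leq_addl.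
exists s'; split => //.
  by apply: leq_trans h3 _; rewrite /= sz; apply/leqW/leq_addl.
move=> y /h5; rewrite inE => yp; apply: st; rewrite inE mem_cat inE.
by case/orP: yp => ->; rewrite ?orbT.
Qed.

(** The random graph of density [1 / q] as a uniform object: a pair is an edge when its colour is
    0. *)
Definition colour_adj (V : finType) q (c : {ffun {set V} -> 'I_q}) : rel V :=
  fun x y => (x != y) && (c [set x; y] == 0 :> nat).

Lemma colour_adj_sym (V : finType) q (c : {ffun {set V} -> 'I_q}) :
  symmetric (colour_adj c).
Proof. by move=> x y; rewrite /colour_adj eq_sym setUC. Qed.

Lemma set2_eq (V : finType) (x y x' y' : V) :
  [set x; y] = [set x'; y'] -> (x = x' /\ y = y') \/ (x = y' /\ y = x').
Proof.
move=> E; have h z : (z \in [set x; y]) = (z \in [set x'; y']) by rewrite E.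
have := h x; have := h y; have := h x'; have := h y'; rewrite !inE !eqxx ?orbT /=.
move=> /orP[]/eqP y'E /orP[]/eqP x'E /esym/orP[]/eqP yE /esym/orP[]/eqP xE;
  by [left; split; congruence | right; split; congruence].
Qed.

Lemma next_next_neq (V : eqType) (t : seq V) x :
  uniq t -> 2 < size t -> x \in t -> next t (next t x) != x.
Proof.
move=> ut st xt; have [i p E] := rot_to xt.
rewrite -!(next_rot i ut) E.
have ur : uniq (x :: p) by rewrite -E rot_uniq.
have : 2 < size (x :: p) by rewrite -E size_rot.
case: p ur {E} => [|y [|z p]] //= /and4P[xN yN _ _] _.
rewrite eqxx; move: xN; rewrite !inE !negb_or => /and3P[xy xz _].
by rewrite [y == x]eq_sym (negbTE xy) eqxx eq_sym.
Qed.

(** A cycle of length at least 3 has as many distinct edges as vertices, each of colour 0 with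
    probability [1 / q]. *)
Lemma card_cycle_colourings (V : finType) q (t : seq V) :
  uniq t -> 2 < size t ->
  q ^ size t * #|[set c : {ffun {set V} -> 'I_q} | cycle (colour_adj c) t]|
    <= #|{: {ffun {set V} -> 'I_q}}|.
Proof.
move=> ut st.
pose h x := [set x; next t x].
have hinj : {in t &, injective h}.
  move=> x y xt yt /set2_eq [[] //|[exy eyx]].
  by have := next_next_neq ut st xt; rewrite eyx -exy eqxx.
pose D := [set h x | x in [set x in t]].
have cD : #|D| = size t.
  rewrite card_in_imset; last by move=> x y; rewrite !inE; apply: hinj.
  by rewrite cardsE; apply/card_uniqP.
rewrite -{1}cD card_ffun -[leqRHS]mul1n -[X in _ <= X * _](exp1n #|D|).
apply: (leq_trans _ (card_ffun_constrained_weighted (D := D) (k := q)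
  (U := fun _ => [set o : 'I_q | o == 0 :> nat]) _)).
  rewrite leq_mul2l; apply/orP; right; apply/subset_leq_card/subsetP => c.
  rewrite !inE => ct; apply/forall_inP => B /imsetP [x]; rewrite inE => xt ->.
  by have /andP[_] := next_cycle ct xt; rewrite inE.
move=> _ _; rewrite mul1n card_ord -[leqRHS]muln1 leq_mul2l; apply/orP; right.
apply/card_le1_eqP => a b; rewrite !inE => /eqP a0 /eqP b0; apply/val_inj.
by rewrite /= a0 b0.
Qed.

(** Disjointness makes the [#|S| * #|T|] pairs distinct, so their colours are independent. *)
Lemma card_hole_colourings (V : finType) q (S T : {set V}) :
  0 < q -> [disjoint S & T] ->
  q ^ (#|S| * #|T|) * #|[set c : {ffun {set V} -> 'I_q} |
      [forall x in S, forall y in T, ~~ colour_adj c x y]]|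
    <= q.-1 ^ (#|S| * #|T|) * #|{: {ffun {set V} -> 'I_q}}|.
Proof.
move=> q_gt0 dST.
pose h (z : V * V) := [set z.1; z.2].
have hinj : {in setX S T &, injective h}.
  move=> [x y] [x' y']; rewrite !inE /= => /andP[xS yT] /andP[xS' yT'].
  move/set2_eq => /= [[-> ->] //|[E _]].
  by have := disjointFr dST xS; rewrite E yT'.
pose D := [set h z | z in setX S T].
have cD : #|D| = #|S| * #|T| by rewrite card_in_imset // cardsX.
rewrite -cD card_ffun.
apply: (leq_trans _ (card_ffun_constrained_weighted (D := D) (k := q)
  (U := fun _ => [set o : 'I_q | o != 0 :> nat]) _)).
  rewrite leq_mul2l; apply/orP; right; apply/subset_leq_card/subsetP => c.
  rewrite !inE => /forall_inP hc; apply/forall_inP => B /imsetP [[x y]].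
  rewrite !inE /= => /andP[xS yT] ->.
  have := forall_inP (hc x xS) y yT; rewrite /colour_adj.
  suff -> : x != y by [].
  by apply: contraTneq yT => <-; rewrite (disjointFr dST xS).
move=> _ _; rewrite card_ord mulnC leq_mul2r; apply/orP; right.
have -> : [set o : 'I_q | o != 0 :> nat] = [set~ Ordinal q_gt0].
  by apply/setP => o; rewrite !inE -(inj_eq val_inj).
by rewrite cardsC1 card_ord.
Qed.

(* Bernoulli's inequality for [(1 + 1 / (q - 1)) ^ q]. *)
Lemma expn_double_pred q : 0 < q -> 2 * q.-1 ^ q <= q ^ q.
Proof.
case: q => // a _ /=.
have h l : a ^ l.+1 + l.+1 * a ^ l <= a.+1 ^ l.+1.
  elim: l => [|l IH]; first by rewrite !expn1 expn0 muln1 addn1.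
  rewrite [leqRHS]expnS; apply: leq_trans (leq_mul (leqnn a.+1) IH).
  rewrite !expnS; nia.
by apply: leq_trans (h a); rewrite expnS; nia.
Qed.

Lemma exists_sparse_bi_dense (g k : nat) :
  2 < g -> 3 < k ->
  exists (L : finType) (e : rel L),
    [/\ symmetric e,
        forall s, cycle e s -> odd (size s) -> g < size s,
        bi_dense e (4 * k ^ (4 * g).-1),
        k ^ (4 * g) <= 2 * #|L| & #|L| <= k ^ (4 * g)].
Proof.
move=> g3 k3; set M := k ^ (4 * g).
have k_gt0 : 0 < k by lia.
(* The average degree is about [M / q = k ^ 2], so short cycles cover few vertices, while
   [si * si = 4 * q * M] makes holes of size [si] unlikely. *)
pose q := k ^ (4 * g).-2; pose si := 2 * k ^ (4 * g).-1.
have q_gt0 : 0 < q by rewrite expn_gt0 k_gt0.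
have M_gt0 : 0 < M by rewrite expn_gt0 k_gt0.
have Mq : M = k ^ 2 * q by rewrite -expnD; congr (_ ^ _); lia.
have siE : si * si = q * (4 * M).
  rewrite /si /q /M [RHS]mulnCA [LHS]mulnACA -!expnD; congr (_ * k ^ _); lia.
pose V := 'I_M; pose K := {ffun {set V} -> 'I_q}.
have K_gt0 : 0 < #|{: K}| by rewrite card_ffun card_ord expn_gt0 q_gt0.
pose bad1 := [set c : K | [exists S : {set V}, exists T : {set V},
  [&& #|S| == si, #|T| == si, [disjoint S & T] &
      [forall x in S, forall y in T, ~~ colour_adj c x y]]]].
have cbad1 : 4 * #|bad1| <= #|{: K}|.
  pose Y (i : {set V} * {set V}) : {set K} :=
    if [&& #|i.1| == si, #|i.2| == si & [disjoint i.1 & i.2]]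
    then [set c : K | [forall x in i.1, forall y in i.2, ~~ colour_adj c x y]]
    else set0.
  have h : q ^ (si * si) * #|bad1|
      <= #|{: {set V} * {set V}}| * (q.-1 ^ (si * si) * #|{: K}|).
    apply: (card_union_bound (Y := Y)) => [c|[S T]].
      rewrite inE => /existsP[S /existsP[T /and4P[cS cT dST hc]]].
      by exists (S, T); rewrite /Y /= cS cT dST inE.
    rewrite /Y /=; case: ifP => [/and3P[/eqP cS /eqP cT dST]|_].
      by have := card_hole_colourings q_gt0 dST; rewrite cS cT.
    by rewrite cards0 muln0.
  (* As [(1 - 1 / q) ^ q <= 1 / 2], a given hole has probability at most [2 ^ (- 4 M)], against
     [4 ^ M] pairs of sets. *)
  have hq : 4 * #|{: {set V} * {set V}}| * q.-1 ^ (si * si) <= q ^ (si * si).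
    rewrite siE !(expnM _ q) card_prod !card_set_type card_ord -expnD.
    apply: leq_trans (_ : (2 * q.-1 ^ q) ^ (4 * M) <= _); last first.
      by rewrite leq_exp2r ?expn_double_pred // muln_gt0.
    rewrite expnMn leq_mul2r -[4]/(2 ^ 2) -expnD leq_exp2l //; apply/orP; right; lia.
  have P_gt0 : 0 < q ^ (si * si) by rewrite expn_gt0 q_gt0.
  rewrite -(leq_pmul2l P_gt0) mulnCA; apply: leq_trans (leq_mul (leqnn 4) h) _.
  by rewrite (mulnA 4) (mulnA (4 * _)) leq_mul2r; apply/orP; right; exact: hq.
pose short (c : K) (v : V) := [exists l : 'I_g.+1, exists t : l.-tuple V,
  [&& 2 < l, uniq t, cycle (colour_adj c) t & v \in t]].
pose Bd c := [set v | short c v].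
pose Z := [set u : K * V | short u.1 u.2].
(* For length [l], there are [M ^ l] tuples with [l] vertices each, and each is a cycle with
   probability at most [q ^ (- l)]: in expectation at most [l * k ^ (2 l)] vertices. *)
have cZ : #|Z| <= g.+1 * (g * k ^ (2 * g) * #|{: K}|).
  pose Y (l : 'I_g.+1) := [set u : K * V | [exists t : l.-tuple V,
    [&& 2 < l, uniq t, cycle (colour_adj u.1) t & u.2 \in t]]].
  rewrite -[#|Z|]mul1n -[g.+1 in leqRHS](card_ord g.+1).
  apply: (card_union_bound (Y := Y)) => [u|l].
    by rewrite inE => /existsP[l hl]; exists l; rewrite inE.
  have ql_gt0 : 0 < q ^ l by rewrite expn_gt0 q_gt0.
  rewrite mul1n -(leq_pmul2l ql_gt0).
  pose Y' (t : l.-tuple V) : {set K * V} :=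
    if (2 < l) && uniq t
    then setX [set c : K | cycle (colour_adj c) t] [set v in t] else set0.
  have h : q ^ l * #|Y l| <= #|{: l.-tuple V}| * (#|{: K}| * l).
    apply: (card_union_bound (Y := Y')) => [u|t].
      rewrite inE => /existsP[t /and4P[h1 h2 h3 h4]]; exists t.
      by rewrite /Y' h1 h2 !inE h3.
    rewrite /Y'; case: ifP => [/andP[l2 ut]|_]; last by rewrite cards0 muln0.
    rewrite cardsX mulnA leq_mul //.
      have := @card_cycle_colourings V q t ut; rewrite size_tuple; exact.
    by rewrite cardsE; apply: leq_trans (card_size _) _; rewrite size_tuple.
  apply: leq_trans h _; rewrite card_tuple card_ord; move: #|{: K}| => NK.
  have l_g : l <= g by rewrite -ltnS ltn_ord.
  rewrite Mq expnMn -expnM -mulnA mulnCA leq_mul2l; apply/orP; right.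
  rewrite mulnCA [leqRHS]mulnC leq_mul2l (mulnC g); apply/orP; right.
  by rewrite leq_mul // leq_pexp2l // leq_mul2l l_g orbT.
pose bad2 := [set c : K | M < 2 * #|Bd c|].
(* Markov's inequality, as the expected number of vertices on short cycles is at most [M / 8]. *)
have cbad2 : 4 * #|bad2| <= #|{: K}|.
  have h : #|bad2| * M <= 2 * #|Z|.
    rewrite card_sum_sections1 big_distrr /= -sum_nat_const.
    rewrite [leqRHS](bigID (mem bad2)) /=; apply: leq_trans (leq_addr _ _).
    apply: leq_sum => c; rewrite inE => /ltnW /leq_trans; apply.
    rewrite leq_mul2l /=; apply/subset_leq_card/subsetP => v; by rewrite !inE.
  have hM : 8 * (g.+1 * (g * k ^ (2 * g))) <= M.
    have -> : M = k ^ (2 * g) * k ^ (2 * g) by rewrite -expnD; congr (_ ^ _); lia.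
    rewrite !mulnA leq_mul2r; apply/orP; right.
    apply: leq_trans (_ : 8 ^ g <= _); last first.
      rewrite expnM leq_exp2r //; last by lia.
      by rewrite (@leq_trans (4 * 4)) // -mulnn leq_mul.
    have -> : 8 ^ g = 2 ^ g * 2 ^ g * 2 ^ g by rewrite -!expnMn.
    rewrite !leq_mul //; first by rewrite -[8]/(2 ^ 3) leq_exp2l.
      exact: ltn_expl.
    exact/ltnW/ltn_expl.
  rewrite -(leq_pmul2r M_gt0) -mulnA; apply: leq_trans (leq_mul (leqnn 4) h) _.
  rewrite mulnA; apply: leq_trans (leq_mul (leqnn _) cZ) _.
  rewrite [leqRHS]mulnC (mulnA g.+1) (mulnA (4 * 2)) leq_mul2r; apply/orP; right.
  exact: hM.
have [c] : exists c : K, (c \notin bad1) && (c \notin bad2).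
  apply/existsP; rewrite -[X in is_true X]negbK negb_exists; apply/negP => /forallP h.
  have : #|{: K}| <= #|bad1| + #|bad2|.
    apply: leq_trans (leq_of_leqif (leq_card_setU bad1 bad2)).
    rewrite -cardsT; apply/subset_leq_card/subsetP => c _.
    by have := h c; rewrite negb_and !negbK in_setU.
  lia.
case/andP => c1 c2.
(* All vertices on cycles of length 3 to [g] are deleted, fewer than or exactly half of [V]. *)
pose L := {v : V | v \notin Bd c}; pose e : rel L := relpre val (colour_adj c).
have cL : #|{: L}| = #|~: Bd c|.
  by rewrite card_sig; apply: eq_card => v; rewrite !inE.
exists L, e; split.
- by move=> x y; apply: colour_adj_sym.
- move=> s cs os; rewrite ltnNge; apply/negP => sg.
  have cs' : cycle (colour_adj c) (map val s) by rewrite cycle_map.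
  have [|s' [h1 h2 h3 h4 h5]] := odd_cycle_uniq cs'; first by rewrite size_map.
  rewrite size_map in h3.
  have s2 : 2 < size s'.
    case: s' h1 h2 {h3 h4 h5} => [|x [|y [|z s']]] //=.
    by rewrite /colour_adj eqxx.
  case: s' h1 h2 h3 h4 h5 s2 => // v s' h1 h2 h3 h4 h5 s2.
  have /mapP [x _ vx] := h5 v (mem_head _ _).
  have := valP x; rewrite -vx inE => /negP; apply.
  have lt : size (v :: s') < g.+1 by rewrite ltnS; apply: leq_trans h3 sg.
  apply/existsP; exists (Ordinal lt); apply/existsP; exists (in_tuple (v :: s')).
  by apply/and4P; split => //; rewrite mem_head.
- move=> S T cS cT.
  have [S0 S0S cS0] : exists2 S0 : {set V}, S0 \subset val @: S & #|S0| = si.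
    apply: subset_of_card; rewrite card_imset; last exact: val_inj.
    by apply: leq_trans cS; rewrite /si leq_mul2r orbT.
  (* The bound [2 * si] on the sizes of [S] and [T] leaves room to choose [T0] disjoint from
     [S0]. *)
  have [T0 T0T cT0] : exists2 T0 : {set V}, T0 \subset (val @: T) :\: S0 & #|T0| = si.
    apply: subset_of_card; rewrite cardsD card_imset; last exact: val_inj.
    have : #|(val @: T) :&: S0| <= si by rewrite -cS0 subset_leq_card // subsetIr.
    by move: cT; rewrite /si; move: (k ^ _) #|_ :&: _| #|_|; lia.
  have : ~~ [forall x in S0, forall y in T0, ~~ colour_adj c x y].
    apply: contra c1 => h; rewrite inE; apply/existsP; exists S0.
    apply/existsP; exists T0; rewrite cS0 cT0 !eqxx h andbT /=.
    rewrite disjoint_sym disjoints_subset; apply: subset_trans T0T _.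
    by apply/subsetP => x; rewrite !inE => /andP[].
  rewrite negb_forall_in => /exists_inP [x /(subsetP S0S) /imsetP [x' xS ->]].
  rewrite negb_forall_in => /exists_inP [y /(subsetP T0T)].
  rewrite in_setD => /andP[_ /imsetP [y' yT ->]]; rewrite negbK => exy.
  by exists x', y'.
- rewrite cL; have := cardsC (Bd c); rewrite card_ord.
  move: c2; rewrite inE -leqNgt; move: #|Bd c| #|~: Bd c|; lia.
- by rewrite cL; apply: leq_trans (max_card _) _; rewrite card_ord.
Qed.

(** * The random hypergraph *)

Definition part0 : 'I_3 := @Ordinal 3 0 isT.
Definition part1 : 'I_3 := @Ordinal 3 1 isT.
Definition part2 : 'I_3 := @Ordinal 3 2 isT.

Lemma part_cases (i : 'I_3) : [\/ i = part0, i = part1 | i = part2].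
Proof.
by case: i => [[|[|[|//]]] ilt]; [constructor 1|constructor 2|constructor 3];
  apply/val_inj.
Qed.

Definition restriction (V L : finType) n (f : 'I_3 * 'I_n -> V)
    (chi : {ffun V * V -> L}) : configuration n L :=
  ([ffun c => ([ffun a => chi (f (part2, c), f (part0, a))],
               [ffun b => chi (f (part2, c), f (part1, b))])],
   [ffun c => ([ffun a => chi (f (part0, a), f (part2, c))],
               [ffun b => chi (f (part1, b), f (part2, c))])],
   [ffun z => (chi (f (part0, z.1), f (part1, z.2)),
               chi (f (part1, z.2), f (part0, z.1)))]).

Lemma restriction_ext (V L : finType) n (f f' : 'I_3 * 'I_n -> V)
    (chi : {ffun V * V -> L}) :
  f =1 f' -> restriction f chi = restriction f' chi.
Proof.
move=> ff'; congr (_, _, _); apply/ffunP => z; rewrite !ffunE ?ff' //;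
  by congr pair; apply/ffunP => a; rewrite !ffunE !ff'.
Qed.

(** Writes a configuration onto the ordered pairs between distinct parts and keeps all other labels;
    with [restriction] it forms the pair of maps for [card_resample]. *)
Definition overwrite (V L : finType) n (f : 'I_3 * 'I_n -> V)
    (chi : {ffun V * V -> L}) (w : configuration n L) : {ffun V * V -> L} :=
  [ffun u => match [pick x | f x == u.1], [pick x | f x == u.2] with
   | Some (i, a), Some (j, b) =>
     match val i, val j with
     | 2, 0 => (w.1.1 a).1 b
     | 2, 1 => (w.1.1 a).2 b
     | 0, 2 => (w.1.2 b).1 a
     | 1, 2 => (w.1.2 b).2 a
     | 0, 1 => (w.2 (a, b)).1
     | 1, 0 => (w.2 (b, a)).2
     | _, _ => chi u
     end
   | _, _ => chi u
   end].

Lemma pick_preimage (X V : finType) (f : X -> V) x :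
  injective f -> [pick y | f y == f x] = Some x.
Proof.
move=> fI; case: pickP => [y /eqP /fI -> //|/(_ x)].
by rewrite eqxx.
Qed.

Lemma restriction_overwrite (V L : finType) n (f : 'I_3 * 'I_n -> V) chi
    (w : configuration n L) :
  injective f -> restriction f (overwrite f chi w) = w.
Proof.
move=> fI; case: w => [[tau xi] p]; rewrite /restriction.
congr (_, _, _); apply/ffunP => z; rewrite !ffunE.
- rewrite [RHS]surjective_pairing.
  by congr pair; apply/ffunP => a; rewrite !ffunE /= !pick_preimage.
- rewrite [RHS]surjective_pairing.
  by congr pair; apply/ffunP => a; rewrite !ffunE /= !pick_preimage.
rewrite [RHS]surjective_pairing.
by congr pair; rewrite /= !pick_preimage // -surjective_pairing.
Qed.

Lemma overwrite_restriction (V L : finType) n (f : 'I_3 * 'I_n -> V) chi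
    (w : configuration n L) :
  injective f -> overwrite f (overwrite f chi w) (restriction f chi) = chi.
Proof.
move=> fI; apply/ffunP => -[u v]; rewrite !ffunE /=.
case: pickP => [[i a] /= /eqP <-|_] //; case: pickP => [[j b] /= /eqP <-|_] //.
by case: (part_cases i) => ->; case: (part_cases j) => ->; rewrite /= ?ffunE /= ?ffunE.
Qed.

(** A uniform labelling restricts along an injective [f] to a uniform configuration. *)
Lemma card_edgeless_restriction (V L : finType) (e : rel L) n
    (f : 'I_3 * 'I_n -> V) k c :
  injective f ->
  k * #|[set w : configuration n L | edgeless e w]| <= c * #|{: configuration n L}| ->
  k * #|[set chi : {ffun V * V -> L} | edgeless e (restriction f chi)]|
    <= c * #|{: {ffun V * V -> L}}|.
Proof.
move=> fI h; rewrite -[#|{: {ffun _ -> _}}|]cardsT.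
refine (@card_resample _ (configuration n L : finType) (restriction f) (overwrite f) _ _
  (fun _ => [set w | edgeless e w]) k c _ _ _ _ _ _) => //.
- by move=> chi w; apply: restriction_overwrite.
- by move=> chi w; apply: overwrite_restriction.
- by move=> chi; rewrite !inE.
Qed.

Lemma exists_colouring g q lam :
  2 < g -> 0 < q -> 2 ^ 96 <= lam -> lam ^ (109 * g) <= 64 * q ->
  exists (L : finType) (e : rel L) (chi : {ffun 'I_(lam ^ q) * 'I_(lam ^ q) -> L}),
    [/\ symmetric e, forall s, cycle e s -> odd (size s) -> g < size s
      & forall f : 'I_3 * 'I_(64 * q) -> 'I_(lam ^ q), injective f ->
          ~~ edgeless e (restriction f chi)].
Proof.
move=> g3 q_gt0 lamB lamq.
have lam256 : 256 <= lam by apply: leq_trans lamB; rewrite -[256]/(2 ^ 8) leq_exp2l.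
have lam_gt0 : 0 < lam by apply: leq_trans lam256.
(* With [s = 4 * k ^ (4 g - 1)], the factor 24 gives [3 * s * kap = k ^ (4 g) / 2 <= #|L|]. The
   saving [kap] is a power of [lam] large enough for the union bound over [f]. *)
pose kap := lam ^ 8; pose k := 24 * kap.
have kap_gt0 : 0 < kap by rewrite expn_gt0 lam_gt0.
have k9 : k <= lam ^ 9 by rewrite expnS leq_mul2r (leq_trans _ lam256) ?orbT.
have k3 : 3 < k by rewrite /k; lia.
have [L [e [eS eodd eD cL1 cL2]]] := exists_sparse_bi_dense g3 k3.
have kE : k ^ (4 * g) = k * k ^ (4 * g).-1 by rewrite -expnS; congr (_ ^ _); lia.
have L_gt0 : 0 < #|L|.
  have : 0 < k ^ (4 * g) by rewrite expn_gt0; lia.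
  lia.
have sk : 3 * (4 * k ^ (4 * g).-1) * kap <= #|L|.
  have : 24 * (kap * k ^ (4 * g).-1) <= 2 * #|L|.
    by apply: leq_trans cL1; rewrite kE /k mulnA.
  lia.
have mn : 256 * #|L| ^ 3 <= 64 * q.
  apply: leq_trans lamq.
  have h : #|L| ^ 3 <= lam ^ (108 * g).
    apply: leq_trans (_ : (lam ^ (36 * g)) ^ 3 <= _); last first.
      by rewrite -expnM leq_pexp2l //; lia.
    rewrite leq_exp2r //; apply: leq_trans cL2 _.
    apply: leq_trans (_ : (lam ^ 9) ^ (4 * g) <= _).
      by rewrite leq_exp2r // muln_gt0 /=; lia.
    by rewrite -expnM leq_pexp2l //; lia.
  apply: leq_trans (leq_mul lam256 h) _.
  by rewrite -expnS leq_pexp2l //; lia.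
have main := card_edgeless (erefl (64 * q)) q_gt0 eS eD kap_gt0 L_gt0 sk mn.
set n := 64 * q in mn main *; set V := 'I_(lam ^ q).
pose Om := {ffun V * V -> L}.
pose bad := [set chi : Om | [exists f : {ffun 'I_3 * 'I_n -> V},
  injectiveb f && edgeless e (restriction f chi)]].
have cbad : kap ^ (64 * q ^ 2) * #|bad|
    <= #|{: {ffun 'I_3 * 'I_n -> V}}| * (2 ^ (6 * n ^ 2) * #|{: Om}|).
  pose Y (f : {ffun 'I_3 * 'I_n -> V}) : {set Om} :=
    if injectiveb f then [set chi : Om | edgeless e (restriction f chi)] else set0.
  apply: (card_union_bound (Y := Y)) => [chi|f].
    by rewrite inE => /existsP[f /andP[fI fe]]; exists f; rewrite /Y fI inE.
  rewrite /Y; case: ifP => [/injectiveP fI|_]; last by rewrite cards0 muln0.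
  exact: card_edgeless_restriction main.
have Om_gt0 : 0 < #|{: Om}| by rewrite card_ffun expn_gt0 L_gt0.
(* In powers of [lam], the maps [f] cost [192 * q ^ 2] and the factor [2 ^ (6 * n ^ 2)] at most
   [256 * q ^ 2], below the saving [512 * q ^ 2]. *)
have num : #|{: {ffun 'I_3 * 'I_n -> V}}| * 2 ^ (6 * n ^ 2) < kap ^ (64 * q ^ 2).
  rewrite card_ffun card_prod !card_ord.
  have -> : 6 * n ^ 2 = 96 * (256 * q ^ 2) by rewrite /n; lia.
  rewrite -expnM (expnM 2).
  have h : (2 ^ 96) ^ (256 * q ^ 2) <= lam ^ (256 * q ^ 2).
    by rewrite leq_exp2r // muln_gt0 expn_gt0 q_gt0.
  apply: leq_ltn_trans (leq_mul (leqnn _) h) _.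
  rewrite -expnD -expnM ltn_exp2l; last by apply: leq_trans lam256.
  have : 0 < q ^ 2 by rewrite expn_gt0 q_gt0.
  rewrite /n; lia.
have [chi hchi] : exists chi, chi \notin bad.
  apply/existsP; rewrite -[X in is_true X]negbK negb_exists; apply/negP => /forallP h.
  have bT : bad = setT by apply/setP => chi; have := h chi; rewrite negbK in_setT.
  move: cbad; rewrite bT cardsT mulnA leq_pmul2r //.
  by rewrite leqNgt num.
exists L, e, chi; split => // f fI.
apply: contra hchi => fe; rewrite inE; apply/existsP; exists [ffun x => f x].
apply/andP; split; first by apply/injectiveP => x y; rewrite !ffunE => /fI.
by rewrite (@restriction_ext _ _ _ _ f) // => x; rewrite ffunE.
Qed.

(** * The 3-graph of a labelling *)

Definition colouring_threegraph (V L : finType) (e : rel L)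
    (chi : {ffun V * V -> L}) : threegraph V :=
  @hgraph 3 V (fun E : {set V} => [forall v in E, forall u in E, forall w in E,
    [&& v != u, v != w & u != w] ==> e (chi (v, u)) (chi (v, w))]).

(** The image of a cycle may repeat labels, so it is only a closed walk; hence odd closed walks, not
    just odd cycles, are excluded in [e]. *)
Lemma cycle_link_colouring (V L : finType) (e : rel L)
    (chi : {ffun V * V -> L}) (v : V) (s : seq {u : V | u != v}) :
  cycle (adj (link (colouring_threegraph e chi) v)) s ->
  cycle e [seq chi (v, val u) | u <- s].
Proof.
rewrite cycle_map; apply: sub_cycle => u w; rewrite /adj /= !inE.
case/andP=> cuw /andP[_ /forall_inP h].
have uw : u != w by apply: contraTneq cuw => ->; rewrite setUid cards1.
have /forall_inP/(_ (val u) _)/forall_inP/(_ (val w) _)/implyP := h v (setU11 _ _).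
apply.
- by rewrite in_setU1 imset_f ?orbT // set21.
- by rewrite in_setU1 imset_f ?orbT // set22.
by rewrite !(eq_sym v) (valP u) (valP w) (inj_eq val_inj) uw.
Qed.

(** A copy with parts of size [n'] contains one with parts of size [n], which allows [n] to be a
    multiple of 64. *)
Lemma no_tripartite_complement (V L : finType) (e : rel L)
    (chi : {ffun V * V -> L}) n n' :
  symmetric e -> n <= n' ->
  (forall f : 'I_3 * 'I_n -> V, injective f -> ~~ edgeless e (restriction f chi)) ->
  ~ contains_copy (complete_tripartite n') (complement (colouring_threegraph e chi)).
Proof.
move=> eS nn' h [f fI fe].
pose f' (x : 'I_3 * 'I_n) := f (x.1, widen_ord nn' x.2).
have f'I : injective f'.
  by move=> [i a] [j b] /fI [/= -> ab]; congr pair; apply/val_inj.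
have := h f' f'I; rewrite negb_forall => /existsP [[a b]].
rewrite negb_forall => /existsP [c]; rewrite negbK inE /= !ffunE /=.
rewrite /f' /= => /and3P[h0 h1 h2].
(* [E] is the transversal through [a], [b], [c]: the copy makes its image a non-edge, while [h0],
   [h1], [h2] make it an edge. *)
pose t (i : 'I_3) := widen_ord nn' (match val i with 0 => a | 1 => b | _ => c end).
pose E := [set (i, t i) | i : 'I_3].
have tI : injective (fun i => (i, t i)) by move=> i j [].
have := fe E; rewrite inE [X in _ -> is_true X]inE.
rewrite [#|E|]card_imset // card_ord eqxx /=.
have -> : [forall i, #|[set x in E | x.1 == i]| == 1].
  apply/forallP => i; apply/cards1P; exists (i, t i); apply/setP => x.
  rewrite !inE; apply/andP/eqP => [[/imsetP[j _ ->] /= /eqP -> //]|->].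
  by rewrite imset_f.
move=> /(_ isT) /andP[c3 /negP]; apply; rewrite inE c3 /=.
apply/forall_inP => _ /imsetP[_ /imsetP[i _ ->] ->].
apply/forall_inP => _ /imsetP[_ /imsetP[j _ ->] ->].
apply/forall_inP => _ /imsetP[_ /imsetP[l _ ->] ->].
apply/implyP.
case: (part_cases i) => ->; case: (part_cases j) => ->; case: (part_cases l) => ->;
  rewrite ?eqxx ?andbF //= => _; by [|rewrite eS].
Qed.

(** * Choice of parameters *)

(** Take [q = n %/ 64] and [lam] maximal with [lam ^ (109 * g) <= 64 * q]. Maximality and
    [lam.+1 <= lam ^ 2] give [64 * q < lam ^ (218 * g)], and one more factor [lam] covers
    [n <= 128 * q]. *)
Lemma exists_base_parameters g B : 0 < g -> 1 < B ->
  exists n0, forall n, n0 <= n ->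
  exists q lam, [/\ 0 < q, 64 * q <= n <= 128 * q, B <= lam,
    lam ^ (109 * g) <= 64 * q & n <= lam ^ (219 * g)].
Proof.
move=> g_gt0 B1; exists (64 * (B ^ (109 * g)).+1) => n hn.
pose q := n %/ 64; have nE := divn_eq n 64; rewrite -/q in nE.
have nr : n %% 64 < 64 by rewrite ltn_mod.
have Bq : B ^ (109 * g) < q.
  by move: hn nE nr; move: (B ^ _) (n %% 64); lia.
have ex : exists l, l ^ (109 * g) <= 64 * q.
  by exists B; apply: leq_trans (ltnW Bq) _; rewrite leq_pmull.
have bnd l : l ^ (109 * g) <= 64 * q -> l <= 64 * q.
  by apply: leq_trans; case: l => // l; rewrite -{1}(expn1 l.+1) leq_pexp2l // muln_gt0.
case: (ex_maxnP ex bnd) => lam hlam lmax.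
have Blam : B <= lam.
  by apply: lmax; apply: leq_trans (ltnW Bq) _; rewrite leq_pmull.
have lam1 : 1 < lam := leq_trans B1 Blam.
have q_gt0 : 0 < q by apply: leq_trans Bq.
have n128 : n <= 128 * q.
  by move: nE nr q_gt0; move: (n %% 64); lia.
exists q, lam; split => //; first by rewrite n128 andbT nE mulnC leq_addr.
have lt : 64 * q < lam ^ (218 * g).
  apply: (@leq_trans (lam.+1 ^ (109 * g))).
    by rewrite ltnNge; apply/negP => /lmax; rewrite ltnn.
  have -> : lam ^ (218 * g) = (lam ^ 2) ^ (109 * g).
    by rewrite -expnM; congr (_ ^ _); lia.
  rewrite leq_exp2r ?muln_gt0 //.
  by rewrite -mulnn; nia.
apply: (@leq_trans (2 * lam ^ (218 * g))).
  by move: n128 lt; move: (lam ^ _); lia.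
apply: (@leq_trans (lam ^ (218 * g).+1)); first by rewrite expnS leq_mul2r lam1 orbT.
by rewrite leq_exp2l //; lia.
Qed.

(* Odd girth, real exponents and conclusion *)
From mathcomp Require Import all_classical all_reals all_analysis.

Local Open Scope ring_scope.

(** Lengths are integers, so [g + 1] is a lower bound and strictness survives the infimum, also over
    the empty set. *)
Lemma odd_girth_gt (R : realType) (V : finType) (G : graph V) (g : nat) :
  (forall s, is_cycle G s -> odd (size s) -> (g < size s)%N) ->
  (g%:R%:E < odd_girth R G)%E.
Proof.
move=> h; apply: (@lt_le_trans _ _ (g.+1%:R%:E : \bar R)).
  by rewrite lte_fin ltr_nat.
by apply: le_ereal_inf_tmp => _ [s [cs os] <-]; rewrite lee_fin ler_nat; apply: h.
Qed.

(** Replacing the base [n] by [lam ^ (219 * g)] turns the exponent over [lam] into [n / 128 <= q];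
    this fixes the constant [1 / (219 * 128)]. *)
Lemma powR_le_expn (R : realType) (n g q lam : nat) :
  (0 < g)%N -> (0 < lam)%N -> (n <= lam ^ (219 * g))%N -> (n <= 128 * q)%N ->
  n%:R `^ ((219%:R * 128%:R)^-1 * n%:R / g%:R) <= (lam ^ q)%N%:R :> R.
Proof.
move=> g0 lam0 nlam nq; set x := (X in _ `^ X).
have g0R : (0 : R) < g%:R by rewrite ltr0n.
have x0 : 0 <= x by rewrite /x !mulr_ge0 ?invr_ge0 ?mulr_ge0 ?ler0n.
apply: (@le_trans _ _ ((lam ^ (219 * g))%N%:R `^ x)).
  by apply: ge0_ler_powR; rewrite ?nnegrE ?ler0n // ler_nat.
rewrite natrX -powR_mulrn ?ler0n // -powRrM natrX -[_ ^+ q]powR_mulrn ?ler0n //.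
apply: ler_powR; first by rewrite ler1n.
have -> : (219 * g)%N%:R * x = n%:R / 128%:R.
  by rewrite natrM /x; field; rewrite ?pnatr_eq0 -?lt0n ?g0.
by rewrite ler_pdivrMr ?ltr0n // -natrM ler_nat mulnC.
Qed.

Theorem theorem1p3 (R : realType) :
  exists2 c : R, 0 < c &
    forall g : nat, (3 <= g)%N ->
    exists n0 : nat, forall n : nat, (n0 <= n)%N ->
    exists (V : finType) (Gamma : threegraph V),
      [/\ n%:R `^ (c * n%:R / g%:R) <= #|V|%:R,
          forall v : V, (g%:R%:E < odd_girth R (link Gamma v))%E
        & ~ contains_copy (complete_tripartite n) (complement Gamma)].
Proof.
exists (219%:R * 128%:R)^-1; first by rewrite invr_gt0 mulr_gt0 ?ltr0n.
move=> g g3; have g_gt0 : (0 < g)%N by apply: leq_trans g3.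
have B1 : (1 < 2 ^ 96)%N by rewrite -(expn0 2) ltn_exp2l.
have [n0 hn0] := exists_base_parameters g_gt0 B1.
exists n0 => n /hn0 [q [lam [q0 /andP[qn nq] Blam lamq nlam]]].
have [L [e [chi [eS eodd he]]]] := exists_colouring g3 q0 Blam lamq.
exists 'I_(lam ^ q), (colouring_threegraph e chi); split.
- rewrite card_ord; apply: powR_le_expn => //.
  exact: leq_trans (ltnW B1) Blam.
- move=> v; apply: odd_girth_gt => s /andP[_ /andP[cs _]] os.
  have := eodd _ (cycle_link_colouring cs); rewrite size_map; exact.
- exact: no_tripartite_complement eS qn he.
Qed.
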